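(* Let $0<\lambda^*<1$. For each $n\in\mathbb{N}$ let $((X_i^{(n)},Y_i^{(n)}))_{1\le i\le[\lambda^*n]}$ and $((X_i^{(n)},Y_i^{(n)}))_{[\lambda^*n]+1\le i\le n}$ be two bivariate stationary processes with Lipschitz continuous marginal distribution functions $F$ and $G$, respectively ($F$, $G$ not depending on $n$). Assume that $((X_i^{(n)},Y_i^{(n)}))_{1\le i\le n}$ is $P$-near epoch dependent on an absolutely regular process (in the sense for non-stationary processes given in the context), with approximating constants $(a_k)$, functions $\Phi_t$ and absolute regularity coefficients $(\beta_k)$ satisfying, for some $\delta>0$, $$a_k\Phi_t(k^{-6})=O\big(k^{-6(2+\delta)/\delta}\big)\ \ (k\to\infty,\ \text{uniformly in } t),\qquad \sum_{k=1}^\infty k\,\beta_k^{\delta/(2+\delta)}<\infty,$$ uniformly for all $n$. Let $\tau_F$ and $\tau_G$ denote Kendall's tau of $F$ and $G$, let $\tau_{F,G}=E\,g((X_1,Y_1),(X_2,Y_2))$ where $(X_1,Y_1)\sim F$ and $(X_2,Y_2)\sim G$ are independent and $g$ is the Kendall kernel, and let $\hat k_n=\arg\max_{1\le k\le n}\frac{k}{\sqrt n}|\hat\tau_k-\hat\tau_n|$, where $\hat\tau_k$ is the sample Kendall's tau of $(X_1^{(n)},Y_1^{(n)}),\ldots,(X_k^{(n)},Y_k^{(n)})$. If $\tau_F\ne\tau_G$ and $$\frac{(1-\lambda^* )^2}{2\big((1-\lambda^* )^2+\lambda^*\big)}\ \le\ \frac{\tau_{F,G}-\tau_F}{\tau_G-\tau_F}\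 <\ 1,$$ then $\hat k_n/n\to\lambda^*$ in probability as $n\to\infty$.
   Context: Kendall kernel: $g((x,y),(x',y'))=\mathbf{1}_{(0,\infty)}\{(x'-x)(y'-y)\}-\mathbf{1}_{(-\infty,0)}\{(x'-x)(y'-y)\}$. Kendall's tau of a bivariate distribution $F$ is $\tau_F=E\,g((X,Y),(X',Y'))$ with $(X,Y),(X',Y')$ independent with distribution $F$. The sample Kendall's tau is $\hat\tau_k=\frac{2}{k(k-1)}\sum_{1\le i<j\le k}g((X_i^{(n)},Y_i^{(n)}),(X_j^{(n)},Y_j^{(n)}))$, with $\hat\tau_1=0$. $[x]$ is the integer part. Short-range dependence for possibly non-stationary processes: for sub-$\sigma$-fields $\mathcal{A},\mathcal{B}$ let $\beta(\mathcal{A},\mathcal{B})=E[\operatorname{ess\,sup}\{|P(A|\mathcal{B})-P(A)|:A\in\mathcal{A}\}]$. For an $\mathbb{R}^r$-valued process $(\mathbf{Z}_t)_{t\in\mathbb{Z}}$ (not required to be stationary) with $\mathscr{F}_k^n=\sigma(\mathbf{Z}_k,\ldots,\mathbf{Z}_n)$ (infinite indices permitted), $\beta_k=\sup_{t\in\mathbb{Z}}\beta(\mathscr{F}_{-\infty}^t,\mathscr{F}_{t+k}^\infty)$, and $(\mathbf{Z}_t)$ is absolutely regular if $\beta_k\to0$. A process $(\mathbf{X}_t)$ is $P$-near epoch dependent on $(\mathbf{Z}_t)$ if there are constants $a_k\to0$, measurable functions $f_{k,t}$, and non-increasing functions $\Phi_t:(0,\infty)\to(0,\infty)$ such that $P(|\mathbf{X}_t-f_{k,t}(\mathbf{Z}_{t-k},\ldots,\mathbf{Z}_{t+k})|_1>\varepsilon)\le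 a_k\Phi_t(\varepsilon)$ for all $k\in\mathbb{N}$, $\varepsilon>0$ and all time indices $t$ of the process ($|\cdot|_1$ the $1$-norm). Here $\mathbf{X}_t=(X_t^{(n)},Y_t^{(n)})$, $1\le t\le n$. ''Uniformly for all $n$'' means that the displayed conditions hold with the same $\delta$ and with bounds on the coefficients that do not depend on $n$. *)

(* Defs.v *)
From HB Require Import structures.
From mathcomp Require Import all_boot all_order all_algebra.
From mathcomp Require Import all_classical all_reals all_analysis.
From mathcomp Require Import measurable_realfun.

Set Implicit Arguments.
Unset Strict Implicit.
Unset Printing Implicit Defensive.

Import Order.TTheory GRing.Theory Num.Theory.
Import numFieldNormedType.Exports.

Local Open Scope classical_set_scope.
Local Open Scope ring_scope.

Section kendall.
Context {R : realType}.

Definition kendall_kernel (p q : R * R) : R :=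
  \1_`]0, +oo[ ((q.1 - p.1) * (q.2 - p.2))
  - \1_`]-oo, 0[ ((q.1 - p.1) * (q.2 - p.2)).

Definition cdf2 (F : probability (R * R)%type R) (p : R * R) : R :=
  fine (F (`]-oo, p.1] `*` `]-oo, p.2])).

Definition cross_tau (F G : probability (R * R)%type R) : R :=
  \int[(F \x G)%E]_z kendall_kernel z.1 z.2.

Definition kendall_tau (F : probability (R * R)%type R) : R := cross_tau F F.

(* For k <= 1 the double sum is empty, so that the value is 0. *)
Definition sample_tau (p : nat -> R * R) (k : nat) : R :=
  2%:R / (k%:R * (k%:R - 1))
  * \sum_(1 <= j < k.+1) \sum_(1 <= i < j) kendall_kernel (p i) (p j).

Definition change_stat (p : nat -> R * R) (n k : nat) : R :=
  k%:R / Num.sqrt n%:R * `|sample_tau p k - sample_tau p n|.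

(* The maximiser need not be unique. *)
Definition is_argmax (p : nat -> R * R) (n m : nat) : Prop :=
  (1 <= m <= n)%N /\
  forall k, (1 <= k <= n)%N -> change_stat p n k <= change_stat p n m.

Definition norm1 (p : R * R) : R := `|p.1| + `|p.2|.

End kendall.

Section processes.
Context {R : realType} {d : measure_display} {T : measurableType d}.
Variable P : probability T R.

(* Joint laws of all windows inside the time segment lo, ..., hi agree. *)
Definition stationary_on {d'} {S : measurableType d'} (W : nat -> T -> S)
    (lo hi : nat) : Prop :=
  forall l i j : nat, (lo <= i)%N -> (i + l <= hi.+1)%N ->
    (lo <= j)%N -> (j + l <= hi.+1)%N ->
  forall D : set (l.-tuple S), measurable D ->
    P [set w | D [tuple W (i + s)%N w | s < l]] =
    P [set w | D [tuple W (j + s)%N w | s < l]].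

(* In the two definitions below a sub-sigma-field is given by its family of
   events; h is a version of the conditional probability of A given B.  For a
   sub-sigma-field B and an event A one exists by Radon-Nikodym and is a.e.
   unique, so the default value in cond_prob is never used. *)
Definition is_cond_prob (B : set (set T)) (A : set T) (h : T -> R) : Prop :=
  [/\ forall D, measurable D -> B (h @^-1` D),
      P.-integrable setT (EFin \o h) &
      forall D, B D -> (\int[P]_(w in D) (h w)%:E)%E = P (A `&` D)].

Definition cond_prob (B : set (set T)) (A : set T) : T -> R :=
  xget (cst 0) [set h | is_cond_prob B A h].

(* Essential supremum of a family of functions (the library's ess_sup is that
   of a single function): the a.e. least measurable function that is an a.e.
   upper bound of each member.  It exists for every family of measurable
   functions and is a.e. unique. *)
Definition is_family_ess_sup (H : set (T -> \bar R)) (eta : T -> \bar R) :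
    Prop :=
  [/\ measurable_fun setT eta,
      forall h, H h -> {ae P, forall w, (h w <= eta w)%E} &
      forall eta', measurable_fun setT eta' ->
        (forall h, H h -> {ae P, forall w, (h w <= eta' w)%E}) ->
        {ae P, forall w, (eta w <= eta' w)%E}].

Definition family_ess_sup (H : set (T -> \bar R)) : T -> \bar R :=
  xget (cst 0%E) [set eta | is_family_ess_sup H eta].

Definition beta_fields (A B : set (set T)) : \bar R :=
  (\int[P]_w family_ess_sup
     [set h | exists2 E, A E &
        h = (fun w => `|(cond_prob B E w)%:E - P E|)] w)%E.

Definition sigma_process {d'} {S : measurableType d'} (Z : int -> T -> S)
    (I : set int) : set (set T) :=
  <<s \bigcup_(s in I) preimage_set_system setT (Z s) measurable >>.

Definition beta_coef {d'} {S : measurableType d'} (Z : int -> T -> S)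
    (k : nat) : \bar R :=
  ereal_sup [set beta_fields (sigma_process Z [set s | s <= t])
                             (sigma_process Z [set s | t + k%:Z <= s])
            | t in [set: int]].

Definition absolutely_regular {d'} {S : measurableType d'}
    (Z : int -> T -> S) : Prop := beta_coef Z @ \oo --> 0%E.

(* The process W is indexed by 1, ..., n, the process Z by the integers. *)
Definition P_NED {r : nat} (n : nat) (W : nat -> T -> R * R)
    (Z : int -> T -> r.-tuple R) (a : nat -> R) (Phi : nat -> R -> R) : Prop :=
  [/\ a @ \oo --> 0,
      forall t, (1 <= t <= n)%N ->
        (forall e, 0 < e -> 0 < Phi t e) /\
        (forall e e', 0 < e -> e <= e' -> Phi t e' <= Phi t e) &
      exists f : forall k : nat, nat -> k.*2.+1.-tuple (r.-tuple R) -> R * R,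
      forall k t, (0 < k)%N -> (1 <= t <= n)%N ->
        measurable_fun setT (f k t) /\
        forall e, 0 < e ->
          (P [set w | (e < norm1 (W t w -
               f k t [tuple Z (t%:Z - k%:Z + (s : nat)%:Z) w | s < k.*2.+1]))%R]
           <= (a k * Phi t e)%:E)%E].

End processes.

(* Main.v *)
Require Import Defs.
From HB Require Import structures.
From mathcomp Require Import all_boot all_order all_algebra.
From mathcomp Require Import all_classical all_reals all_analysis.
From mathcomp Require Import measurable_realfun.
From mathcomp Require Import zify ring lra.

Set Implicit Arguments.
Unset Strict Implicit.
Unset Printing Implicit Defensive.

Import Order.TTheory GRing.Theory Num.Theory.
Import numFieldNormedType.Exports.

Local Open Scope classical_set_scope.
Local Open Scope ring_scope.

(** Why the theorem holds.  The kernel is symmetric and vanishes on the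
    diagonal, so k (k - 1) times the sample tau of the first k observations is
    the double sum over all i, j <= k of the kernel (sample_tauE).  Divided by
    n^2 it is the integral of the kernel against the square of the measure
    (1/n) (sum over i <= k of the Dirac mass at W_i).  A law of large numbers
    for functions of single observations is therefore enough.

    Law of large numbers (LLN_uniform).  For a set C whose boundary is null for
    F and for G, the indicators of C at times i and j are almost uncorrelated
    when j - i is large, uniformly in n (cov_uniform): near epoch dependence
    replaces each of them by an event of a finite window of the underlying
    process (NED_cov), and absolute regularity bounds the covariance of a past
    and of a future event (beta_coef_ge).  Chebyshev's inequality at boundedly
    many values of k then controls all k <= n at once, because neighbouring
    partial sums differ by at most 1.  For beta_coef_ge to say anything, the
    conditional probabilities and the essential supremum in the definition of
    beta must exist; the first come from the Radon-Nikodym theorem on the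
    sub-sigma-field, the second from a countable subfamily that exhausts the
    supremum of the integrals.

    From single observations to pairs (pair_sum_approx).  Cut each axis by a
    fine grid such that every strip has small mass; this is possible since the
    Lipschitz distribution functions make the marginals diffuse
    (fine_grid_exists).  The kernel at (p, q) depends only on the cells of p
    and q unless they share a strip, and that event has small weight.  The
    double sum thus becomes a quadratic form in the cell counts, to which the
    law of large numbers applies.  Its limit at k = s n is the quadratic form
    pair_limit at s (pair_sum_uniform).

    The limit profile.  The rescaled criterion is uniformly close to
    profile s = | pair_limit s / s - s * pair_limit 1 | (change_stat_approx).
    Up to lam the profile is linear and increasing; after lam the two bounds on
    (tau_FG - tau_F) / (tau_G - tau_F) keep it below its value at lam by a
    margin that is uniform away from lam (profile_gap).  A maximiser of a
    criterion that is uniformly close to such a profile lies close to lam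
    (argmax_near). *)

(** * Conditional probabilities and the coefficient of absolute regularity *)

Section conditional_probability.
Context {R : realType} {d : measure_display} {T : measurableType d}.
Variable P : probability T R.
Local Open Scope ereal_scope.

Lemma sub_sigma_measurable (G : set (set T)) :
  G `<=` measurable -> <<s G >> `<=` (measurable : set (set T)).
Proof.
by move=> GM; apply: smallest_sub => //; exact: sigma_algebra_measurable.
Qed.

(** Restrict P and the measure D |-> P (E & D) to the sigma-field generated by
    G, realised as the measurable structure of a copy S of T; the density of the
    second with respect to the first is the conditional probability.  The
    identity T -> S carries its integrals back to T. *)
Lemma cond_prob_exists (G : set (set T)) (E : set T) :
  G `<=` measurable -> measurable E -> exists h, is_cond_prob P <<s G >> E h.
Proof.
move=> GM mE.
have BM := sub_sigma_measurable GM.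
pose S : measurableType _ := g_sigma_algebraType G.
have mid : measurable_fun [set: T] (id : T -> S).
  by move=> _ D mD; rewrite setTI; exact: BM.
pose i : {mfun T >-> S} := HB.pack (id : T -> S) (isMeasurableFun.Build _ _ _ _ _ mid).
pose Q : probability S R := distribution P i.
pose nu0 : {charge set S -> \bar R} :=
  [the {charge set S -> \bar R} of
   pushforward (crestr (charge_of_finite_measure P) mE) i].
pose nu := nu0 mid.
have nuQ : nu `<< Q.
  apply/null_content_dominatesP => A mA QA0.
  apply/eqP; rewrite eq_le /nu /nu0/= /pushforward/= /crestr/=.
  rewrite measure_ge0 andbT -[leRHS]QA0 /Q /distribution /pushforward.
  apply: le_measure; rewrite ?inE//.
  - by apply: measurableI => //; exact: BM.
  - exact: BM.
pose g := Radon_Nikodym nu Q.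
have gi : Q.-integrable setT g by exact: Radon_Nikodym_integrable.
have gfin x : g x \is a fin_num by exact: Radon_Nikodym_fin_num.
have gE : EFin \o (fine \o g) = g by apply/funext => x /=; rewrite fineK.
have mg : measurable_fun [set: S] g by exact: measurable_int gi.
have gPi : P.-integrable setT g.
  apply/integrableP; split.
    by move=> _ D mD; rewrite setTI; apply: BM; rewrite -[_ @^-1` _]setTI; exact: mg.
  case/integrableP : gi => _; apply: le_lt_trans.
  by rewrite [leRHS](@ge0_integral_distribution _ _ T S _ P i)//; exact: measurableT_comp.
exists (fine \o g); split.
- move=> D mD; rewrite -[_ @^-1` _]setTI.
  suff : measurable_fun [set: S] (fine \o g) by exact.
  exact: measurableT_comp.
- by rewrite gE.
- move=> D BD; under eq_integral => w _ do rewrite /= fineK//.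
  rewrite setIC -[RHS]/(nu D) (@Radon_Nikodym_integral _ _ _ nu Q D nuQ BD).
  rewrite (integral_pushforward (phi := i))//=.
  by apply: (integrableS measurableT) => //; exact: BM.
Qed.

Lemma cond_probP (G : set (set T)) (E : set T) :
  G `<=` measurable -> measurable E ->
  is_cond_prob P <<s G >> E (cond_prob P <<s G >> E).
Proof.
move=> GM mE; have [h hP] := cond_prob_exists GM mE.
exact: (xgetPex (cst 0%R) (ex_intro _ h hP)).
Qed.

Lemma ae_notin_pos (f : T -> R) (D : set T) :
  measurable D -> P.-integrable setT (EFin \o f) ->
  (forall x, D x -> (0 < f x)%R) -> \int[P]_(x in D) (f x)%:E <= 0 ->
  {ae P, forall x, ~ D x}.
Proof.
move=> mD fi f0 If.
have mf : measurable_fun D (EFin \o f).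
  by apply: (measurable_funS measurableT) => //; exact: measurable_int fi.
have /(ae_eq_integral_abs P mD mf) : \int[P]_(x in D) `|(EFin \o f) x| = 0.
  apply/eqP; rewrite eq_le integral_ge0 ?andbT; last by move=> *; exact: abse_ge0.
  apply: le_trans If; rewrite le_eqVlt; apply/orP; left; apply/eqP.
  by apply: eq_integral => x /set_mem Dx /=; rewrite gtr0_norm// f0.
apply: filterS => x + Dx => /(_ Dx) /= [] fx0.
by have := f0 _ Dx; rewrite fx0 ltxx.
Qed.

(** On the event where h exceeds 1, which lies in the sub-sigma-field, the
    integral of h - 1 is P (E & D) - P D <= 0; likewise for h < 0.  The bound is
    what makes the essential supremum below integrable. *)
Lemma cond_prob_bounds (G : set (set T)) (E : set T) (h : T -> R) :
  G `<=` measurable -> measurable E -> is_cond_prob P <<s G >> E h ->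
  {ae P, forall x, (0 <= h x <= 1)%R}.
Proof.
move=> GM mE [mh hi hE].
have BM := sub_sigma_measurable GM.
have B1 : <<s G >> (h @^-1` `]1%R, +oo[) by apply: mh; exact: measurable_itv.
have B0 : <<s G >> (h @^-1` `]-oo, 0%R[) by apply: mh; exact: measurable_itv.
have hiD D : measurable D -> P.-integrable D (EFin \o h).
  by move=> mD; apply: (integrableS measurableT).
have c1 D : measurable D -> P.-integrable D (EFin \o cst 1%R).
  by move=> mD; exact: finite_measure_integrable_cst.
have ae1 : {ae P, forall x, ~ (h @^-1` `]1%R, +oo[) x}.
  apply: (@ae_notin_pos (fun x => h x - 1)%R); first exact: BM.
  - rewrite (_ : _ \o _ = (EFin \o h) \- (EFin \o cst 1%R))//.
    by apply: integrableB => //; exact: c1.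
  - by move=> x /=; rewrite in_itv/= andbT subr_gt0.
  - under eq_integral do rewrite EFinB.
    rewrite (integralB_EFin _ (hiD _ (BM _ B1)) (c1 _ (BM _ B1)))//=; last exact: BM.
    rewrite hE// integral_cst//=; last exact: BM.
    rewrite mul1e leeBlDr ?fin_num_measure//; last exact: BM.
    rewrite add0e; apply: le_measure; rewrite ?inE//; last exact: BM.
      by apply: measurableI => //; exact: BM.
have ae0 : {ae P, forall x, ~ (h @^-1` `]-oo, 0%R[) x}.
  apply: (@ae_notin_pos (fun x => - h x)%R); first exact: BM.
  - by rewrite (_ : _ \o _ = -%E \o (EFin \o h))//; apply: integrableN.
  - by move=> x /=; rewrite in_itv/= oppr_gt0.
  - under eq_integral do rewrite EFinN.
    rewrite integralN/=; last first.
      by apply: integrable_add_def; [exact: BM|apply: hiD; exact: BM].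
    by rewrite hE// oppe_le0.
apply: filterS2 ae0 ae1 => x /=; rewrite !in_itv/= andbT => /negP; rewrite -leNgt => ->.
by move=> /negP; rewrite -leNgt => ->.
Qed.

End conditional_probability.

Section essential_supremum.
Context {R : realType} {d : measure_display} {T : measurableType d}.
Variable P : probability T R.
Local Open Scope ereal_scope.

(** Among the suprema of sequences in H choose one, eta, whose integral is the
    supremum M <= 1 of all these integrals.  Adding any h of H to the sequence
    cannot increase the integral further, so the maximum of h and eta equals eta
    almost everywhere. *)
Lemma family_ess_sup_exists (H : set (T -> \bar R)) : H !=set0 ->
  (forall h, H h -> measurable_fun setT h) ->
  (forall h, H h -> forall x, 0 <= h x) ->
  (forall h, H h -> {ae P, forall x, h x <= 1}) ->
  exists eta, is_family_ess_sup P H eta.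
Proof.
move=> [h0 Hh0] mH H0 H1.
pose sp (u : nat -> T -> \bar R) x := esups (u ^~ x) 0%N.
have sp_ge u n x : u n x <= sp u x.
  by apply: ereal_sup_ubound; exists n.
have sp_le u c x : (forall n, u n x <= c) -> sp u x <= c.
  by move=> uc; apply: ge_ereal_sup => _ [n _ <-].
have msp u : (forall n, H (u n)) -> measurable_fun setT (sp u).
  by move=> Hu; apply: measurable_fun_esups => n; exact: mH.
have sp0 u x : (forall n, H (u n)) -> 0 <= sp u x.
  by move=> Hu; apply: le_trans (sp_ge u 0%N x); exact: H0.
have sp1 u : (forall n, H (u n)) -> \int[P]_x sp u x <= 1.
  move=> Hu; rewrite -(probability_setT P) -[leRHS]mul1e -integral_cst//.
  apply: ae_ge0_le_integral => //; first by move=> x _; exact: sp0.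
    exact: msp.
  have /ae_foralln : forall n, {ae P, forall x, u n x <= 1} by move=> n; exact: H1.
  by apply: filterS => x ux _; exact: sp_le.
pose S := [set \int[P]_x sp u x | u in [set u | forall n, H (u n)]].
have S0 : S !=set0 by exists (\int[P]_x sp (fun=> h0) x); exists (fun=> h0).
have M1 : ereal_sup S <= 1 by apply: ge_ereal_sup => _ [u Hu <-]; exact: sp1.
have Mfin : ereal_sup S \is a fin_num.
  rewrite ge0_fin_numE ?(le_lt_trans M1) ?ltry//.
  case: S0 => s Ss; apply: le_trans (ereal_sup_ubound Ss).
  by case: Ss => u Hu <-; apply: integral_ge0 => x _; exact: sp0.
have /choice[U UP] : forall m : nat, exists u : nat -> T -> \bar R,
    (forall n, H (u n)) /\ ereal_sup S - (m.+1%:R^-1)%:E < \int[P]_x sp u x.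
  move=> m; have [] := @ub_ereal_sup_adherent _ S (m.+1%:R^-1) _ Mfin.
    by rewrite invr_gt0.
  by move=> _ [u Hu <-] ?; exists u.
(* One sequence that runs through all the sequences U 0, U 1, ...; the default
   pair is hit when k codes no pair and is harmless. *)
pose v k := let p := odflt (0%N, 0%N) (unpickle k) in U p.1 p.2.
have Hv k : H (v k) by rewrite /v; apply: (UP _).1.
pose eta := sp v.
have Ueta m x : sp (U m) x <= eta x.
  apply: sp_le => n; apply: le_trans (sp_ge v (pickle (m, n)) x).
  by rewrite /v pickleK.
have etaM : ereal_sup S <= \int[P]_x eta x.
  apply/lee_addgt0Pr => _/posnumP[e].
  have [m me] : exists m : nat, (m.+1%:R^-1 < e%:num :> R)%R.
    have [m _ /(_ _ (leqnn m))/= me] := near_infty_natSinv_lt e.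
    by exists m.
  rewrite -leeBlDr//; apply: le_trans (_ : \int[P]_x sp (U m) x <= _).
    apply: le_trans (ltW (UP m).2); apply: leeB => //.
    by rewrite lee_fin ltW.
  apply: ge0_le_integral => //.
  - by move=> x _; apply: sp0 => n; apply: (UP _).1.
  - by apply: msp => n; apply: (UP _).1.
  - exact: msp.
exists eta; split.
- exact: msp.
- move=> h Hh.
  pose w n := if n is m.+1 then v m else h.
  have Hw n : H (w n) by case: n => /=.
  have wE x : sp w x = maxe (h x) (eta x).
    apply/eqP; rewrite eq_le; apply/andP; split.
      by apply: sp_le => -[|n] /=; rewrite le_max ?lexx// (sp_ge v) orbT.
    rewrite ge_max (sp_ge w 0%N)/=.
    by apply: sp_le => n; exact: (sp_ge w n.+1).
  have etai : P.-integrable setT eta.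
    apply/integrableP; split; first exact: msp.
    under eq_integral do rewrite gee0_abs ?sp0//.
    exact: le_lt_trans (sp1 _ Hv) (ltry _).
  have wi : P.-integrable setT (sp w).
    apply/integrableP; split; first exact: msp.
    under eq_integral do rewrite gee0_abs ?sp0//.
    exact: le_lt_trans (sp1 _ Hw) (ltry _).
  have we x : eta x <= sp w x by rewrite wE le_max lexx orbT.
  have ae_fin : {ae P, forall x, eta x \is a fin_num}.
    by apply: filterS (integrable_ae measurableT etai) => x /(_ I).
  have mwe : measurable_fun setT (sp w \- eta).
    by apply: emeasurable_funB; exact: msp.
  have /(ae_eq_integral_abs P measurableT mwe) :
      \int[P]_x `|(sp w \- eta) x| = 0.
    rewrite (ae_eq_integral (sp w \- eta))//; last 2 first.
    - exact: measurableT_comp.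
    - by apply: filterS ae_fin => x fx _; rewrite gee0_abs// sube_ge0 ?fx.
    rewrite integralB//; apply/eqP; rewrite eq_le; apply/andP; split.
      rewrite leeBlDr ?integrable_fin_num// add0e (le_trans _ etaM)//.
      by apply: ereal_sup_ubound; exists w.
    rewrite sube_ge0 ?integrable_fin_num//; apply: ge0_le_integral => //.
    - by move=> x _; exact: sp0.
    - exact: msp.
    - exact: msp.
  apply: filterS2 ae_fin => x fx /(_ I) /= wx0.
  have : sp w x <= eta x by rewrite -[leRHS]add0e -leeBlDr// wx0.
  by apply: le_trans; rewrite wE le_max lexx.
- move=> eta' meta' ub.
  have /ae_foralln : forall n, {ae P, forall x, v n x <= eta' x}.
    by move=> n; exact: ub.
  by apply: filterS => x; exact: sp_le.
Qed.

(** P (A & B) - P A P B is the integral over B of P(A | B-field) - P A, whose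
    absolute value is at most the essential supremum almost everywhere. *)
Lemma beta_fields_ge (GA GB : set (set T)) (A B : set T) :
  GA `<=` measurable -> GB `<=` measurable -> <<s GA >> A -> <<s GB >> B ->
  `|P (A `&` B) - P A * P B| <= beta_fields P <<s GA >> <<s GB >>.
Proof.
move=> GAM GBM hA hB.
have AM := sub_sigma_measurable GAM.
have BM := sub_sigma_measurable GBM.
pose dev (E : set T) w := `|(cond_prob P <<s GB >> E w)%:E - P E|.
pose H := [set h | exists2 E, <<s GA >> E & h = dev E].
have cpP E : <<s GA >> E -> is_cond_prob P <<s GB >> E (cond_prob P <<s GB >> E).
  by move=> /AM mE; exact: cond_probP.
have cpi E : <<s GA >> E -> P.-integrable setT (EFin \o cond_prob P <<s GB >> E).
  by move=> /cpP[].
have mdev E : <<s GA >> E -> measurable_fun setT (dev E).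
  move=> hE; apply: measurableT_comp => //; apply: emeasurable_funB => //.
  exact: measurable_int (cpi _ hE).
have [eta0 eta0P] : exists eta, is_family_ess_sup P H eta.
  apply: family_ess_sup_exists.
  - by exists (dev A); exists A.
  - by move=> _ [E hE ->]; exact: mdev.
  - by move=> _ [E hE ->] x; exact: abse_ge0.
  - move=> _ [E hE ->]; have /= := cond_prob_bounds GBM (AM _ hE) (cpP _ hE).
    apply: filterS => x /andP[c0 c1]; rewrite /dev.
    have mE := AM _ hE.
    rewrite -[P E]fineK ?fin_num_measure// -EFinB abse_EFin lee_fin.
    have p0 : (0 <= fine (P E))%R by rewrite fine_ge0.
    have p1 : (fine (P E) <= 1)%R.
      by rewrite -lee_fin fineK ?fin_num_measure//; exact: probability_le1.
    by rewrite ler_norml; apply/andP; split; lra.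
have [meta ub _] : is_family_ess_sup P H (family_ess_sup P H).
  exact: (xgetPex (cst 0) (ex_intro _ eta0 eta0P)).
set eta := family_ess_sup P H in meta ub.
have devA : {ae P, forall x, dev A x <= eta x} by apply: ub; exists A.
(* eta is nonnegative only almost everywhere; its positive part has the same
   integral and allows monotonicity of the integral to be used. *)
rewrite [leRHS](_ : _ = \int[P]_x eta^\+ x); last first.
  apply: ae_eq_integral => //; first exact: measurable_funepos.
  apply: filterS devA => x dx _; rewrite funeposE max_l//.
  by apply: le_trans dx; exact: abse_ge0.
have mA := AM _ hA; have mB := BM _ hB.
have Pfin E : measurable E -> P E \is a fin_num by move=> mE; exact: fin_num_measure.
have -> : P (A `&` B) - P A * P B =
    \int[P]_(x in B) ((cond_prob P <<s GB >> A x)%:E - P A).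
  have [_ cpiA cpE] := cpP _ hA.
  rewrite integralB//.
  - by rewrite cpE// integral_cst.
  - exact: (integrableS measurableT).
  - by rewrite -[P A]fineK ?Pfin//; exact: finite_measure_integrable_cst.
apply: (@le_trans _ _ (\int[P]_(x in B) dev A x)).
  apply: le_abse_integral => //.
  apply: emeasurable_funB => //; apply: (measurable_funS measurableT) => //.
  exact: measurable_int (cpi _ hA).
apply: (@le_trans _ _ (\int[P]_x dev A x)).
  by apply: ge0_subset_integral => //; [exact: mdev|move=> x _; exact: abse_ge0].
apply: ae_ge0_le_integral => //.
- by move=> x _; exact: abse_ge0.
- exact: mdev.
- exact: measurable_funepos.
- apply: filterS devA => x dx _; apply: le_trans dx _.
  by rewrite funeposE le_max lexx.
Qed.

Section process.
Context {d' : measure_display} {S : measurableType d'}.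
Variable Z : int -> T -> S.
Hypothesis mZ : forall t, measurable_fun setT (Z t).

Lemma sigma_process_gen_measurable (I : set int) :
  \bigcup_(s in I) preimage_set_system setT (Z s) measurable `<=` measurable.
Proof. by move=> _ [s _ [A mA <-]]; exact: mZ. Qed.

Lemma beta_coef_ge (t : int) (k : nat) (A B : set T) :
  sigma_process Z [set s | (s <= t)%R] A ->
  sigma_process Z [set s | (t + k%:Z <= s)%R] B ->
  `|P (A `&` B) - P A * P B| <= beta_coef P Z k.
Proof.
move=> hA hB; apply: (@le_trans _ _ (beta_fields P
    (sigma_process Z [set s | (s <= t)%R]) (sigma_process Z [set s | (t + k%:Z <= s)%R]))).
  by apply: beta_fields_ge => //; exact: sigma_process_gen_measurable.
by apply: ereal_sup_ubound; exists t.
Qed.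

Lemma sigma_process_tuple (I : set int) (l : nat) (s : 'I_l -> int)
    (D : set (l.-tuple S)) : (forall i, I (s i)) -> measurable D ->
  sigma_process Z I [set w | D [tuple Z (s i) w | i < l]].
Proof.
move=> Is mD.
pose G := \bigcup_(s in I) preimage_set_system setT (Z s) measurable.
pose Q : measurableType _ := g_sigma_algebraType G.
have mf : measurable_fun [set: Q] (fun w : Q => [tuple Z (s i) w | i < l]).
  apply/measurable_fun_tnthP => i.
  rewrite (_ : _ \o _ = Z (s i)); last by apply/funext => w; rewrite /= tnth_mktuple.
  move=> _ C mC; rewrite setTI; apply: sub_sigma_algebra.
  by exists (s i) => //; exists C => //; rewrite setTI.
by have := mf measurableT _ mD; rewrite setTI.
Qed.

End process.

End essential_supremum.

(** * Second moment bound for sums of weakly correlated indicators *)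

Section second_moment.
Context {R : realType} {d : measure_display} {T : measurableType d}.
Variable P : probability T R.

Lemma fine_probability_bounds (A : set T) : measurable A -> 0 <= fine (P A) <= 1.
Proof.
move=> mA; rewrite fine_ge0//= -lee_fin fineK ?fin_num_measure//.
exact: probability_le1.
Qed.

Lemma le_fine_probability (A B : set T) :
  measurable A -> measurable B -> A `<=` B -> fine (P A) <= fine (P B).
Proof.
move=> mA mB AB; apply: fine_le; rewrite ?fin_num_measure//.
by apply: le_measure => //; rewrite inE.
Qed.

Lemma integrable_scaled_indic (a : R) (A : set T) :
  measurable A -> P.-integrable setT (EFin \o (fun x => a * \1_A x)).
Proof.
move=> mA; rewrite (_ : _ \o _ = fun x => (a%:E * (EFin \o \1_A) x)%E)//.
by apply: integrableZl => //; exact: integrable_indic.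
Qed.

Lemma Rintegral_scaled_indic (a : R) (A : set T) :
  measurable A -> \int[P]_x (a * \1_A x) = a * fine (P A).
Proof.
move=> mA; rewrite RintegralZl//; last exact: integrable_indic.
by rewrite /Rintegral integral_indic// setIT.
Qed.

Lemma integrable_sumR (I : Type) (s : seq I) (f : I -> T -> R) :
  (forall i, P.-integrable setT (EFin \o f i)) ->
  P.-integrable setT (EFin \o (fun x => \sum_(i <- s) f i x)).
Proof.
move=> fi; rewrite (_ : _ \o _ = fun x => (\sum_(i <- s) (f i x)%:E)%E).
  by apply: integrable_sum => // i _; exact: fi.
by apply/funext => x /=; rewrite sumEFin.
Qed.

Lemma Rintegral_sum (I : Type) (s : seq I) (f : I -> T -> R) :
  (forall i, P.-integrable setT (EFin \o f i)) ->
  \int[P]_x (\sum_(i <- s) f i x) = \sum_(i <- s) \int[P]_x f i x.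
Proof.
move=> fi; elim: s => [|i s IH].
  rewrite big_nil -[RHS](mul0r (fine (P setT))) -Rintegral_cst//.
  by apply: eq_Rintegral => x _; rewrite big_nil.
rewrite big_cons -IH -RintegralD//; last exact: integrable_sumR.
by apply: eq_Rintegral => x _; rewrite big_cons.
Qed.

Lemma centered_indic_prodE (a b : R) (A B : set T) x :
  (\1_A x - a) * (\1_B x - b) =
  1 * \1_(A `&` B) x + ((- a) * \1_B x + ((- b) * \1_A x + a * b * \1_setT x)) :> R.
Proof. rewrite indicI/= indicT. by rewrite /cst/=; ring. Qed.

Lemma integrable_centered_indic (a b : R) (A B : set T) :
  measurable A -> measurable B ->
  P.-integrable setT (EFin \o (fun x => (\1_A x - a) * (\1_B x - b))).
Proof.
move=> mA mB.
rewrite (_ : _ \o _ = (EFin \o (fun x => 1 * \1_(A `&` B) x)%R) \+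
  ((EFin \o (fun x => - a * \1_B x)%R) \+ ((EFin \o (fun x => - b * \1_A x)%R) \+
   (EFin \o (fun x => a * b * \1_setT x)%R)))%E); last first.
  by apply/funext => x /=; rewrite centered_indic_prodE !EFinD.
do ![apply: integrableD => //]; apply: integrable_scaled_indic => //.
exact: measurableI.
Qed.

Lemma Rintegral_centered_indic (A B : set T) :
  measurable A -> measurable B ->
  \int[P]_x ((\1_A x - fine (P A)) * (\1_B x - fine (P B))) =
  fine (P (A `&` B)) - fine (P A) * fine (P B).
Proof.
move=> mA mB; under eq_Rintegral do rewrite centered_indic_prodE.
have mAB : measurable (A `&` B) by exact: measurableI.
rewrite !RintegralD//; do ?exact: integrable_scaled_indic.
- rewrite !Rintegral_scaled_indic// probability_setT/=; ring.
- rewrite (_ : _ \o _ = (EFin \o (fun x => - fine (P B) * \1_A x)%R) \+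
   (EFin \o (fun x => fine (P A) * fine (P B) * \1_setT x)%R))%E//.
  by apply: integrableD => //; exact: integrable_scaled_indic.
- rewrite (_ : _ \o _ = (EFin \o (fun x => - fine (P A) * \1_B x)%R) \+
   ((EFin \o (fun x => - fine (P B) * \1_A x)%R) \+
   (EFin \o (fun x => fine (P A) * fine (P B) * \1_setT x)%R)))%E//.
  by do ![apply: integrableD => //]; exact: integrable_scaled_indic.
Qed.

(** At most 2 q + 1 indices lie within distance q of i. *)
Lemma count_near (i q k : nat) :
  (\sum_(1 <= j < k.+1 | (i <= j + q)%N && (j <= i + q)%N) 1 <= (2 * q).+1)%N.
Proof.
rewrite sum1_count -size_filter.
apply: leq_trans (_ : size (index_iota (i - q) (i + q).+1) <= _)%N; last first.
  by rewrite size_iota; lia.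
apply: uniq_leq_size; first by rewrite filter_uniq// iota_uniq.
move=> j; rewrite mem_filter !mem_index_iota; lia.
Qed.

Section deviation.
Variables (A : nat -> set T) (eps : R) (q k : nat).
Hypothesis mA : forall i, (1 <= i <= k)%N -> measurable (A i).
Let p i := fine (P (A i)).
Hypothesis eps0 : 0 <= eps.
Hypothesis small_cov : forall i j, (1 <= i)%N -> (i + q < j)%N -> (j <= k)%N ->
  `|fine (P (A i `&` A j)) - p i * p j| <= eps.

(** Chebyshev's inequality.  Of the k^2 covariances, at most k (2 q + 1) belong
    to indices at distance at most q and are bounded by 1; all the others are
    bounded by eps. *)
Lemma prob_indicator_sum_deviation (c : R) : 0 < c ->
  (P [set w | (c <= `|\sum_(1 <= i < k.+1) (\1_(A i) w - p i)|)%R] <=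
   ((k%:R ^+ 2 * eps + k%:R * (2 * q).+1%:R) / c ^+ 2)%:E)%E.
Proof.
move=> c0.
(* Events outside the range 1, ..., k are replaced by the empty set, so that all
   of them are measurable. *)
pose A' i := if (1 <= i <= k)%N then A i else set0.
have mA' i : measurable (A' i).
  by rewrite /A'; case: ifPn => // /mA.
pose p' i := fine (P (A' i)).
have AE i : (1 <= i < k.+1)%N -> A' i = A i by rewrite /A' ltnS => ->.
pose S w := \sum_(1 <= i < k.+1) (\1_(A' i) w - p' i).
have SE w : \sum_(1 <= i < k.+1) (\1_(A i) w - p i) = S w.
  by apply: eq_big_nat => i ik; rewrite /p' /p AE.
under eq_set do rewrite SE.
have S2E w : S w ^+ 2 = \sum_(1 <= i < k.+1) \sum_(1 <= j < k.+1)
    (\1_(A' i) w - p' i) * (\1_(A' j) w - p' j).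
  by rewrite expr2 /S mulr_suml; apply: eq_bigr => i _; rewrite mulr_sumr.
have ci i j : P.-integrable setT
    (EFin \o (fun w => (\1_(A' i) w - p' i) * (\1_(A' j) w - p' j))).
  exact: integrable_centered_indic.
have ci2 i : P.-integrable setT (EFin \o (fun w => \sum_(1 <= j < k.+1)
    (\1_(A' i) w - p' i) * (\1_(A' j) w - p' j))).
  exact: integrable_sumR.
have S2i : P.-integrable setT (EFin \o (fun w => S w ^+ 2)).
  rewrite (_ : (fun w => S w ^+ 2) = (fun w => \sum_(1 <= i < k.+1) \sum_(1 <= j < k.+1)
    (\1_(A' i) w - p' i) * (\1_(A' j) w - p' j))); last by apply/funext.
  exact: integrable_sumR.
have IS2 : \int[P]_w (S w ^+ 2) <= k%:R ^+ 2 * eps + k%:R * (2 * q).+1%:R.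
  under eq_Rintegral do rewrite S2E.
  rewrite Rintegral_sum//.
  apply: (@le_trans _ _ (\sum_(1 <= i < k.+1) (k%:R * eps + (2 * q).+1%:R))); last first.
    rewrite sumr_const_nat subn1/= -[(_ + _) *+ k]mulr_natl mulrDr; lra.
  rewrite big_nat [leRHS]big_nat; apply: ler_sum => i ik.
  rewrite Rintegral_sum//.
  apply: (@le_trans _ _ (\sum_(1 <= j < k.+1) (eps +
      ((i <= j + q)%N && (j <= i + q)%N)%:R))); last first.
    rewrite big_split/= sumr_const_nat subn1/= -[eps *+ k]mulr_natl lerD2l.
    have := count_near i q k; rewrite -(ler_nat R); apply: le_trans.
    by rewrite natr_sum [leRHS]big_mkcond/=; apply: ler_sum => j _; case: ifP.
  rewrite big_nat [leRHS]big_nat; apply: ler_sum => j jk.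
  rewrite Rintegral_centered_indic// !AE//.
  have [|far] /= := boolP ((i <= j + q)%N && (j <= i + q)%N).
    move=> _; have [mi mj] : measurable (A i) /\ measurable (A j) by split; exact: mA.
    have /andP[pi0 pi1] := fine_probability_bounds mi.
    have /andP[pj0 pj1] := fine_probability_bounds mj.
    have /andP[_ pij1] := fine_probability_bounds (measurableI _ _ mi mj).
    have : 0 <= fine (P (A i)) * fine (P (A j)) by exact: mulr_ge0.
    by rewrite /= mulr1n => pp; move: eps0 pij1; lra.
  rewrite addr0; apply: le_trans (ler_norm _) _.
  have [ij|] := leqP i j; first by apply: small_cov; lia.
  by move=> ji; rewrite setIC mulrC; apply: small_cov; lia.
have mS2 : measurable_fun setT (EFin \o (fun w => S w ^+ 2)) by exact: measurable_int S2i.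
have c20 : 0 < c ^+ 2 by rewrite exprn_gt0.
have := le_integral_abse P measurableT mS2 c20.
rewrite setTI (_ : [set x | _] = [set w | c <= `|S w|]); last first.
  apply/seteqP; split => w /=;
    rewrite lee_fin (ger0_norm (sqr_ge0 (S w))) -[S w ^+ 2]real_normK ?num_real//.
    by rewrite ler_pXn2r// ?nnegrE// ltW.
  by move=> ?; rewrite ler_pXn2r// ?nnegrE// ltW.
have -> : (\int[P]_x `|(EFin \o (fun w => S w ^+ 2)%R) x| = (\int[P]_w (S w ^+ 2))%R%:E)%E.
  rewrite /Rintegral fineK ?integrable_fin_num//.
  by apply: eq_integral => w _; rewrite /= ger0_norm ?sqr_ge0.
move=> H; rewrite EFinM muleC -lee_pdivrMl ?invr_gt0// invrK.
by apply: le_trans H _; rewrite lee_fin.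
Qed.

End deviation.
End second_moment.

(** * Covariances under near epoch dependence *)

Section approximation.
Context {R : realType} {d : measure_display} {T : measurableType d}.
Variable P : probability T R.

Lemma fine_probabilityU (A B : set T) : measurable A -> measurable B ->
  fine (P (A `|` B)) <= fine (P A) + fine (P B).
Proof.
move=> mA mB; rewrite -fineD ?fin_num_measure//; apply: fine_le.
- by rewrite fin_num_measure//; exact: measurableU.
- by rewrite fin_numD !fin_num_measure.
- exact: measureU2.
Qed.

Lemma fine_probability_approx (A B E : set T) :
  measurable A -> measurable B -> measurable E ->
  A `<=` B `|` E -> fine (P A) <= fine (P B) + fine (P E).
Proof.
move=> mA mB mE AB; apply: le_trans (fine_probabilityU mB mE).
by apply: le_fine_probability => //; exact: measurableU.
Qed.

(** Each of the two events changes only on a set of probability at most eta;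
    this moves the joint probability by at most 2 eta and the product of the
    probabilities by at most 2 eta. *)
Lemma cov_approx (A A' B B' E E' : set T) (eta beta : R) :
  measurable A -> measurable A' -> measurable B -> measurable B' ->
  measurable E -> measurable E' ->
  (forall w, ~ E w -> (A w <-> B w)) -> (forall w, ~ E' w -> (A' w <-> B' w)) ->
  fine (P E) <= eta -> fine (P E') <= eta ->
  `|fine (P (B `&` B')) - fine (P B) * fine (P B')| <= beta ->
  `|fine (P (A `&` A')) - fine (P A) * fine (P A')| <= beta + 4 * eta.
Proof.
move=> mA mA' mB mB' mE mE' AB AB' Ee Ee' cb.
have sub U V (X : set T) : (forall w, ~ X w -> (U w <-> V w)) ->
    U `<=` V `|` X /\ V `<=` U `|` X.
  move=> UV; split => w Hw; have [Xw|/UV[h1 h2]] := pselect (X w);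
    by [right|left; auto].
have [/(fine_probability_approx mA mB mE) h1 /(fine_probability_approx mB mA mE) h2]
  := sub _ _ _ AB.
have [/(fine_probability_approx mA' mB' mE') h3 /(fine_probability_approx mB' mA' mE') h4]
  := sub _ _ _ AB'.
have mAA : measurable (A `&` A') by exact: measurableI.
have mBB : measurable (B `&` B') by exact: measurableI.
have mEE : measurable (E `|` E') by exact: measurableU.
have [] := sub (A `&` A') (B `&` B') (E `|` E').
  by move=> w /not_orP[/AB ? /AB' ?]; split => -[? ?]; split; tauto.
move=> /(fine_probability_approx mAA mBB mEE) h5 /(fine_probability_approx mBB mAA mEE) h6.
have h7 := fine_probabilityU mE mE'.
have /andP[a0 a1] := fine_probability_bounds P mA.
have /andP[a0' a1'] := fine_probability_bounds P mA'.
have /andP[b0 b1] := fine_probability_bounds P mB.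
have /andP[b0' b1'] := fine_probability_bounds P mB'.
move: cb h1 h2 h3 h4 h5 h6 h7 Ee Ee' a0 a1 a0' a1' b0 b1 b0' b1'.
move: (fine _) (fine _) (fine _) (fine _) (fine _) (fine _) (fine _) (fine _) (fine _).
move=> bb b b' a e a' e' aa ee; rewrite !ler_norml => /andP[c1 c2].
move=> *; apply/andP; split; nra.
Qed.

End approximation.

Section near_epoch.
Context {R : realType} {d : measure_display} {T : measurableType d}.
Variable P : probability T R.

(** Outside N, moving a point by at most e does not change membership in C: N
    plays the role of a closed e-neighbourhood of the boundary of C. *)
Definition insensitive_off (C N : set (R * R)) (e : R) :=
  forall p p', norm1 (p - p') <= e -> ~ N p -> (C p <-> C p').

Variables (r n : nat) (W : nat -> {RV P >-> (R * R)%type}).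
Variable Z : int -> {RV P >-> (r.-tuple R)}.
Variables (k : nat) (f : nat -> k.*2.+1.-tuple (r.-tuple R) -> R * R).
Hypothesis mf : forall t, (1 <= t <= n)%N -> measurable_fun setT (f t).
Let V t w := f t [tuple Z (t%:Z - k%:Z + (s : nat)%:Z) w | s < k.*2.+1].

Lemma measurable_NED_approximation t : (1 <= t <= n)%N -> measurable_fun setT (V t).
Proof.
move=> tn; apply: measurableT_comp; first exact: mf.
apply/measurable_fun_tnthP => i.
rewrite (_ : _ \o _ = Z (t%:Z - k%:Z + (i : nat)%:Z)); first by [].
by apply/funext => w; rewrite /= tnth_mktuple.
Qed.

Lemma measurable_NED_error t e : (1 <= t <= n)%N ->
  measurable [set w | e < norm1 (W t w - V t w)].
Proof.
move=> tn.
have mg : measurable_fun setT (fun w => norm1 (W t w - V t w)).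
  have mV := measurable_NED_approximation tn.
  have mW : measurable_fun setT (W t) by [].
  rewrite /norm1/=; apply: measurable_funD; apply: measurableT_comp => //;
    apply: measurable_funB; exact: measurableT_comp.
have := mg measurableT _ (measurable_itv `]e, +oo[); rewrite setTI.
by congr measurable; apply/seteqP; split => w /=; rewrite in_itv/= andbT.
Qed.

(** For t = i the window of the approximation reaches up to time i + k, for t = j
    it starts at j - k.  If these are K apart, absolute regularity applies to
    the approximating events; cov_approx transfers the bound to the events of
    the process W itself. *)
Lemma NED_cov (C : set (R * R)) (e eta beta : R) (K : nat) (N : nat -> set (R * R)) :
  measurable C -> (forall t, measurable (N t)) ->
  (forall t, (1 <= t <= n)%N -> insensitive_off C (N t) e) ->
  (forall t, (1 <= t <= n)%N -> fine (P [set w | N t (W t w)]) <= eta) ->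
  (forall t, (1 <= t <= n)%N ->
     fine (P [set w | e < norm1 (W t w - V t w)]) <= eta) ->
  (beta_coef P Z K <= beta%:E)%E ->
  forall i j, (1 <= i)%N -> (i + (k.*2 + K) <= j)%N -> (j <= n)%N ->
  `|fine (P ([set w | C (W i w)] `&` [set w | C (W j w)])) -
    fine (P [set w | C (W i w)]) * fine (P [set w | C (W j w)])| <= beta + 8 * eta.
Proof.
move=> mC mN insC Neta Veta bK i j i1 ij jn.
have int : (1 <= i <= n)%N by lia.
have jnt : (1 <= j <= n)%N by lia.
have mWS D t : measurable D -> measurable [set w | D (W t w)].
  by move=> mD; rewrite -[X in measurable X]setTI; exact: (measurable_funP (W t)).
have mVC t : (1 <= t <= n)%N -> measurable [set w | C (V t w)].
  by move=> tn; rewrite -[X in measurable X]setTI; exact: (measurable_NED_approximation tn).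
(* The exceptional event: the approximation is bad, or W t is close to the
   boundary of C. *)
pose E t := [set w | e < norm1 (W t w - V t w)] `|` [set w | N t (W t w)].
have mE t : (1 <= t <= n)%N -> measurable (E t).
  by move=> tn; apply: measurableU; [exact: measurable_NED_error|exact: mWS].
have EP t : (1 <= t <= n)%N -> fine (P (E t)) <= 2 * eta.
  move=> tn; apply: le_trans (fine_probabilityU _ _ _) _.
  - exact: measurable_NED_error.
  - exact: mWS.
  - by rewrite mulr2n mulrDl mul1r lerD// ?Veta ?Neta.
have WV t w : (1 <= t <= n)%N -> ~ E t w -> (C (W t w) <-> C (V t w)).
  by move=> tn /not_orP[/negP]; rewrite -leNgt => WVe nN; exact: insC WVe nN.
rewrite (_ : 8 * eta = 4 * (2 * eta)); last by lra.
apply: (@cov_approx _ _ _ P _ _ [set w | C (V i w)] [set w | C (V j w)] (E i) (E j));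
  [exact: mWS|exact: mWS|exact: mVC|exact: mVC|exact: mE|exact: mE|
   by move=> w; exact: WV|by move=> w; exact: WV|exact: EP|exact: EP|].
have mfC t : (1 <= t <= n)%N -> measurable (f t @^-1` C).
  by move=> tn; rewrite -[X in measurable X]setTI; exact: mf.
have := @beta_coef_ge R d T P _ _ Z (fun t => measurable_funP (Z t))
  (i%:Z + k%:Z) K [set w | C (V i w)] [set w | C (V j w)].
have fin D : measurable D -> P D \is a fin_num by move=> mD; exact: fin_num_measure.
have mCi := mVC _ int; have mCj := mVC _ jnt.
rewrite -lee_fin => h; apply: le_trans bK.
rewrite -abse_EFin EFinB EFinM !fineK ?fin//; last exact: measurableI.
apply: h.
- refine (@sigma_process_tuple _ T _ _ (fun u => Z u) _ _
    (fun s : 'I_(k.*2.+1) => i%:Z - k%:Z + (s : nat)%:Z) (f i @^-1` C) _ (mfC _ int)).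
  move=> s /=; have := ltn_ord s; lia.
- refine (@sigma_process_tuple _ T _ _ (fun u => Z u) _ _
    (fun s : 'I_(k.*2.+1) => j%:Z - k%:Z + (s : nat)%:Z) (f j @^-1` C) _ (mfC _ jnt)).
  move=> s /=; have := ltn_ord s; lia.
Qed.

End near_epoch.

(** * Law of large numbers *)

Section summability.
Context {R : realType}.

(** If b k > e, the k-th term is at least e `^ p, but the terms of a convergent
    series tend to 0. *)
Lemma summable_weighted_powR_small (b : nat -> R) (p : R) : 0 < p ->
  (\sum_(1 <= k <oo) (k%:R * b k `^ p)%:E < +oo)%E ->
  forall e, 0 < e -> \forall k \near \oo, b k <= e.
Proof.
move=> p0 bsum e e0.
pose u k := (k%:R * b k `^ p)%:E.
have u0 k : (0 <= u k)%E by rewrite lee_fin mulr_ge0// powR_ge0.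
have : (\sum_(0 <= k <oo) u k < +oo)%E.
  rewrite (nneseries_split 0 1)// big_nat1 /u mul0r add0e.
  exact: bsum.
move/nneseries_tail_cvg => /(_ (fun k _ => u0 k)) tail.
have ep0 : 0 < e `^ p by rewrite powR_gt0.
have tl : \forall N \near \oo, (\sum_(N <= k <oo) u k < (e `^ p)%:E)%E.
  have : nbhs (0%E : \bar R) [set x : \bar R | (x < (e `^ p)%:E)%E].
    by apply: open_nbhs_nbhs; split; [exact: open_ereal_lt_ereal|rewrite /= lte_fin].
  exact: tail.
near=> k.
have k0 : (0 < k)%N by near: k; exists 1%N.
have : (u k < (e `^ p)%:E)%E.
  apply: le_lt_trans (_ : (\sum_(k <= j <oo) u j < _)%E); last by near: k.
  rewrite (nneseries_split k 1)//.
  by rewrite addn1 big_nat1 leeDl// nneseries_ge0.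
rewrite lte_fin leNgt; apply: contraTN => eb; rewrite -leNgt.
apply: le_trans (_ : b k `^ p <= _); last first.
  by rewrite ler_peMl ?powR_ge0// ler1n.
by apply: ge0_ler_powR; rewrite ?nnegrE ltW//; exact: lt_trans eb.
Unshelve. all: by end_near.
Qed.

Lemma near_natV_small (e : R) : 0 < e -> \forall k \near \oo, (k%:R^-1 : R) <= e.
Proof.
move=> e0; near=> k.
have ke : e^-1 <= k%:R :> R by near: k; exact: nbhs_infty_ger.
have k0 : 0 < k%:R :> R by apply: lt_le_trans ke; rewrite invr_gt0.
by rewrite -[leRHS]invrK lef_pV2 ?posrE// invr_gt0.
Unshelve. all: by end_near.
Qed.

Lemma near_powRN_small (c s e : R) : 1 <= s -> 0 < e ->
  \forall k \near \oo, c * k%:R `^ (- s) <= e.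
Proof.
move=> s1 e0.
have e1 : 0 < e / (`|c| + 1) by rewrite divr_gt0// ltr_wpDl.
near=> k.
have k0 : (0 < k)%N by near: k; exists 1%N.
have ke : (k%:R^-1 : R) <= e / (`|c| + 1) by near: k; exact: near_natV_small.
apply: (@le_trans _ _ ((`|c| + 1) * k%:R^-1)); last by rewrite mulrC -ler_pdivlMr// ltr_wpDl.
apply: (@le_trans _ _ ((`|c| + 1) * k%:R `^ (- s))).
  by rewrite ler_wpM2r ?powR_ge0// (le_trans (ler_norm _))// lerDl.
rewrite ler_wpM2l ?addr_ge0// -powR_inv1//.
by apply: ler_powR; rewrite ?ler1n// lerN2.
Unshelve. all: by end_near.
Qed.

End summability.

(** In other words, the boundary of C has measure 0; this form provides directly
    the neighbourhoods N that the covariance bound needs. *)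
Definition continuity_set {R : realType} (F : probability (R * R)%type R)
    (C : set (R * R)) : Prop :=
  forall eps, 0 < eps -> exists e N, [/\ 0 < e, measurable N,
    fine (F N) <= eps & insensitive_off C N e].

Section union_bound.
Context {R : realType} {d : measure_display} {T : measurableType d}.
Variable P : probability T R.

Lemma union_bound (I : eqType) (s : seq I) (E : I -> set T) (eps : R) :
  (forall i, i \in s -> measurable (E i) /\ (P (E i) <= eps%:E)%E) ->
  exists B, [/\ measurable B, (P B <= ((size s)%:R * eps)%:E)%E &
    forall i, i \in s -> E i `<=` B].
Proof.
elim: s => [|i s IH] H.
  by exists set0; split => //=; rewrite measure0 mul0r.
have [|B [mB PB EB]] := IH; first by move=> j js; apply: H; rewrite inE js orbT.
have [mi Pi] : measurable (E i) /\ (P (E i) <= eps%:E)%E by apply: H; rewrite mem_head.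
exists (E i `|` B); split.
- exact: measurableU.
- apply: le_trans (measureU2 _ _ _) _ => //=.
  by rewrite -addn1 natrD addrC mulrDl mul1r EFinD leeD.
- by move=> j; rewrite inE => /orP[/eqP ->|/EB jB] x ?; [left|right; exact: jB].
Qed.

End union_bound.

Section law_of_large_numbers.
Variables (R : realType) (lam : R) (F G : probability (R * R)%type R)
    (d : nat -> measure_display) (T : forall n : nat, measurableType (d n))
    (P : forall n : nat, probability (T n) R)
    (W : forall n : nat, nat -> {RV (P n) >-> (R * R)%type})
    (r : nat -> nat)
    (Z : forall n : nat, int -> {RV (P n) >-> ((r n).-tuple R)})
    (a : nat -> nat -> R) (Phi : nat -> nat -> R -> R)
    (delta c : R) (b : nat -> R).

(** The common law of the observations at time i: F up to the change point, G
    after it. *)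
Definition regime_law (n i : nat) : probability (R * R)%type R :=
  if (i <= Num.truncn (lam * n%:R))%N then F else G.

Hypothesis W_law : forall n i, (1 <= i <= n)%N -> forall A, measurable A ->
  distribution (P n) (W n i) A = regime_law n i A.
Hypothesis W_NED : forall n, (0 < n)%N ->
  P_NED (P n) n (W n) (Z n) (a n) (Phi n).
Hypothesis delta0 : 0 < delta.
Hypothesis NED_rate : \forall k \near \oo, forall n t : nat, (1 <= t <= n)%N ->
  a n k * Phi n t (k%:R ^- 6)
    <= c * k%:R `^ (- (6%:R * (2%:R + delta) / delta)).
Hypothesis beta_le : forall n k : nat, (0 < n)%N -> (0 < k)%N ->
  (beta_coef (P n) (Z n) k <= (b k)%:E)%E.
Hypothesis beta_rate :
  (\sum_(1 <= k <oo) (k%:R * b k `^ (delta / (2%:R + delta)))%:E < +oo)%E.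

Lemma rate_ge1 : 1 <= 6%:R * (2%:R + delta) / delta.
Proof.
rewrite -mulrA; apply: (@le_trans _ _ (6 * 1)); first by lra.
by rewrite ler_wpM2l// ler_pdivlMr// mul1r lerDr.
Qed.

Lemma W_preimage_law n i (A : set (R * R)) : (1 <= i <= n)%N -> measurable A ->
  P n [set w | A (W n i w)] = regime_law n i A.
Proof. by move=> i_n mA; rewrite -W_law. Qed.

Variable C : set (R * R).
Hypothesis mC : measurable C.
Hypothesis FC : continuity_set F C.
Hypothesis GC : continuity_set G C.

Let A n i := [set w | C (W n i w)].
Arguments A n i : clear implicits.

Lemma measurable_hit n i : measurable (A n i).
Proof. by rewrite -[X in measurable X]setTI; exact: (measurable_funP (W n i)). Qed.

(** With window k the NED error at distance k^-6 is at most c k^-s with s >= 1,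
    so one fixed window and one fixed mixing gap K make all the errors small,
    simultaneously for all n. *)
Lemma cov_uniform eps : 0 < eps -> exists q, forall n i j : nat,
  (1 <= i)%N -> (i + q < j)%N -> (j <= n)%N ->
  `|fine (P n (A n i `&` A n j)) - fine (P n (A n i)) * fine (P n (A n j))| <= eps.
Proof.
move=> eps0.
have eta0 : 0 < eps / 16 by lra.
have [eF [NF [eF0 mNF FNF insF]]] := FC eta0.
have [eG [NG [eG0 mNG GNG insG]]] := GC eta0.
have [k [k0 keF keG kc krate]] : exists k : nat, [/\ (0 < k)%N, (k%:R ^- 6 : R) <= eF,
    (k%:R ^- 6 : R) <= eG,
    c * k%:R `^ (- (6%:R * (2%:R + delta) / delta)) <= eps / 16 &
    forall n t : nat, (1 <= t <= n)%N ->
    a n k * Phi n t (k%:R ^- 6)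
    <= c * k%:R `^ (- (6%:R * (2%:R + delta) / delta))].
  near \oo => k; exists k.
  have k0 : (0 < k)%N by near: k; exists 1%N.
  have k6 : (k%:R ^- 6 : R) <= k%:R^-1.
    by rewrite lef_pV2 ?posrE ?exprn_gt0 ?ltr0n// ler_eXnr// ler1n.
  split => //.
  - by apply: le_trans k6 _; near: k; exact: near_natV_small.
  - by apply: le_trans k6 _; near: k; exact: near_natV_small.
  - by near: k; apply: near_powRN_small => //; exact: rate_ge1.
  - by near: k.
have p0 : 0 < delta / (2 + delta) by rewrite divr_gt0// ltr_wpDl.
have [K [K0 bK]] : exists K : nat, (0 < K)%N /\ b K <= eps / 2.
  near \oo => K; exists K; split; first by near: K; exists 1%N.
  by near: K; apply: (summable_weighted_powR_small p0 beta_rate); lra.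
exists (k.*2 + K)%N => n i j i1 ij jn.
have n0 : (0 < n)%N by move: ij jn; clear; lia.
have [a_cv Phi_pos [f fP]] := W_NED n0.
(* The neighbourhood of the boundary is chosen according to the law of W t. *)
pose N t := if (t <= Num.truncn (lam * n%:R))%N then NF else NG.
have mN t : measurable (N t) by rewrite /N; case: ifP.
have ins t : (1 <= t <= n)%N -> insensitive_off C (N t) (k%:R ^- 6).
  move=> _ p p' pp'; rewrite /N; case: ifP => _; [apply: insF|apply: insG];
    exact: le_trans pp' _.
have Nsmall t : (1 <= t <= n)%N -> fine (P n [set w | N t (W n t w)]) <= eps / 16.
  by move=> tn; rewrite W_preimage_law// /regime_law /N; case: ifP.
have Vsmall t : (1 <= t <= n)%N -> fine (P n [set w | k%:R ^- 6 < norm1 (W n t w -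
    f k t [tuple Z n (t%:Z - k%:Z + (s : nat)%:Z) w | s < k.*2.+1])]) <= eps / 16.
  move=> tn; have [mf /(_ (k%:R ^- 6))] := fP k t k0 tn.
  rewrite invr_gt0 exprn_gt0 ?ltr0n// => /(_ isT) err.
  have merr := @measurable_NED_error _ _ _ _ (r n) n (W n) (Z n) k (f k)
    (fun t tn => (fP k t k0 tn).1) t (k%:R ^- 6) tn.
  rewrite -lee_fin fineK ?fin_num_measure//; apply: le_trans err _.
  by rewrite lee_fin (le_trans (krate _ _ tn)).
apply: le_trans (NED_cov (fun t tn => (fP k t k0 tn).1) mC mN ins Nsmall Vsmall
  (beta_le n0 K0) i1 (ltnW ij) jn) _.
lra.
Unshelve. all: by end_near.
Qed.

Let p n i := fine (regime_law n i C).

(** The second moment bound is used at the multiples of st, which is about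
    eta n / 2; there are at most L of them below n, and L does not depend on n.
    Between two multiples the sum varies by at most st. *)
Lemma LLN_uniform eta eps : 0 < eta -> 0 < eps -> \forall n \near \oo,
  exists E, [/\ measurable E, (P n E <= eps%:E)%E &
    forall w, ~ E w -> forall k, (k <= n)%N ->
    `|\sum_(1 <= i < k.+1) (\1_C (W n i w) - p n i)| <= eta * n%:R].
Proof.
move=> eta0 eps0.
(* st >= eta n / 4, so that at most 4 / eta multiples of st are below n. *)
pose L := (Num.truncn (4 / eta)).+1.
have L0 : 0 < L%:R :> R by rewrite ltr0n.
pose eps' := eps / L%:R / 2 * (eta / 2) ^+ 2.
have e20 : 0 < (eta / 2) ^+ 2 by rewrite exprn_gt0// divr_gt0.
have eps'0 : 0 < eps' by rewrite /eps' !mulr_gt0// invr_gt0.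
have [q covq] := cov_uniform eps'0.
near=> n.
have n0 : (0 < n)%N by near: n; exists 1%N.
have nR0 : 0 < n%:R :> R by rewrite ltr0n.
have n_eta : 2 / eta <= n%:R by near: n; exact: nbhs_infty_ger.
have n_q : (2 * q).+1%:R / eps' <= n%:R by near: n; exact: nbhs_infty_ger.
pose st := Num.truncn (eta * n%:R / 2).
have x1 : 1 <= eta * n%:R / 2.
  by move: n_eta; rewrite ler_pdivrMr//; lra.
have st_le : st%:R <= eta * n%:R / 2 by rewrite truncn_le; lra.
have st_gt : eta * n%:R / 2 < st.+1%:R by rewrite -truncn_le_nat.
have st1 : (0 < st)%N.
  by rewrite lt0n; apply/negP => /eqP s0; move: st_gt; rewrite s0; lra.
have st1R : 1 <= st%:R :> R by rewrite ler1n.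
have Lst l : (l * st <= n)%N -> (l < L)%N.
  move=> lst; rewrite ltnNge; apply/negP => Ll.
  have l_ge : 4 / eta < l%:R.
    rewrite (_ : l = l.-1.+1); last by rewrite prednK// (leq_trans _ Ll).
    by rewrite -truncn_le_nat -ltnS prednK ?(leq_trans _ Ll).
  move: lst; apply/negP; rewrite -ltnNge -(ltr_nat R) natrM.
  have st2 : eta * n%:R / 4 < st%:R by move: st_gt st1R; rewrite -[st.+1%:R]natr1; lra.
  have -> : n%:R = 4 / eta * (eta * n%:R / 4) by field; rewrite gt_eqF.
  by apply: ltr_pM => //; [exact/ltW/divr_gt0|apply/ltW; rewrite divr_gt0 ?mulr_gt0].
pose Ei l := [set w | eta / 2 * n%:R <=
  `|\sum_(1 <= i < (minn (l * st) n).+1) (\1_(A n i) w - fine (P n (A n i)))|].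
have mEi l : measurable (Ei l).
  have mS : measurable_fun setT (fun w =>
      `|\sum_(1 <= i < (minn (l * st) n).+1) (\1_(A n i) w - fine (P n (A n i)))|).
    apply: measurableT_comp => //; apply: measurable_sum => i.
    apply: measurable_funB => //; exact/measurable_indic/measurable_hit.
  have := mS measurableT _ (measurable_itv `[eta / 2 * n%:R, +oo[); rewrite setTI.
  by congr measurable; apply/seteqP; split => w /=; rewrite in_itv/= andbT.
have PEi l : (P n (Ei l) <= (eps / L%:R)%:E)%E.
  apply: le_trans (@prob_indicator_sum_deviation _ _ _ (P n) (A n) eps' q
    (minn (l * st) n) _ _ _ _ _) _.
  - by move=> i _; exact: measurable_hit.
  - exact: ltW.
  - by move=> i j i1 ij jk; apply: covq => //; apply: leq_trans jk (geq_minr _ _).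
  - by rewrite mulr_gt0// divr_gt0.
  have : (minn (l * st) n)%:R <= n%:R :> R by rewrite ler_nat geq_minr.
  move: (minn _ _) => k kn.
  rewrite lee_fin exprMn ler_pdivrMr ?mulr_gt0 ?exprn_gt0//.
  have k0 : 0 <= k%:R :> R by [].
  rewrite ler_pdivrMr// in n_q.
  have -> : eps / L%:R * ((eta / 2) ^+ 2 * n%:R ^+ 2) =
      n%:R ^+ 2 * eps' + n%:R * (n%:R * eps') by rewrite /eps'; field; rewrite gt_eqF.
  apply: lerD; first by apply: ler_wpM2r; rewrite ?(ltW eps'0)// ler_sqr ?nnegrE.
  by apply: ler_pM.
have [|B [mB PB EB]] := @union_bound _ _ _ (P n) _ (iota 0 L) Ei (eps / L%:R).
  by move=> i _; split.
exists B; split => //.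
  by apply: le_trans PB _; rewrite size_iota lee_fin mulrC divfK// gt_eqF.
move=> w Bw k kn.
pose l := (k %/ st)%N.
have lk : (l * st <= k)%N by exact: leq_trunc_div.
have lL : (l < L)%N by apply: Lst; exact: leq_trans lk kn.
have : ~ Ei l w by move=> El; apply: Bw; apply: (EB l) El; rewrite mem_iota.
move=> /negP; rewrite -ltNge (minn_idPl _) ?(leq_trans lk)// => Sl.
rewrite (big_cat_nat _ (n := (l * st).+1))//=.
apply: le_trans (ler_normD _ _) _.
have -> : eta * n%:R = eta / 2 * n%:R + eta * n%:R / 2 by lra.
apply: lerD.
  apply: le_trans (ltW Sl); rewrite le_eqVlt; apply/orP; left; apply/eqP; congr `|_|.
  rewrite !big_nat; apply: eq_bigr => i il; congr (_ - _).
  by rewrite /p W_preimage_law//; move: il lk kn; clear; lia.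
apply: le_trans (ler_norm_sum _ _ _) _.
apply: le_trans st_le.
apply: (@le_trans _ _ (\sum_((l * st).+1 <= i < k.+1) 1)).
  rewrite big_nat [leRHS]big_nat; apply: ler_sum => i ik.
  have /andP[q0 q1] : 0 <= p n i <= 1 by exact: fine_probability_bounds.
  by rewrite ler_norml indicE; case: (_ \in _); apply/andP; split; rewrite /=; lra.
rewrite sumr_const_nat ler_nat subSS.
by have := ltn_pmod k st1; have := divn_eq k st; rewrite -/l; clear; lia.
Unshelve. all: by end_near.
Qed.

End law_of_large_numbers.

(** * Strips, grids and cells *)

Section marginals.
Context {R : realType}.
Implicit Types F G : probability (R * R)%type R.

Lemma nondecreasing_union_le {d} {T : measurableType d} (P : probability T R)
    (A : (set T)^nat) (c : R) :
  (forall i, measurable (A i)) -> nondecreasing_seq A ->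
  (forall i, fine (P (A i)) <= c) -> fine (P (\bigcup_n A n)) <= c.
Proof.
move=> mA ndA Ac.
have mU : measurable (\bigcup_n A n) by exact: bigcup_measurable.
have cv := nondecreasing_cvg_mu (mu := P) mA mU ndA.
rewrite -lee_fin fineK ?fin_num_measure//.
apply: (cvge_le _ cv) => //; apply: nearW => n /=.
by rewrite -[leLHS]fineK ?fin_num_measure// lee_fin.
Qed.

Lemma lipschitz_bound (f : R * R -> R) : lipschitz f -> exists2 L, 0 < L &
  forall p q, `|f p - f q| <= L * `|p - q|.
Proof.
move=> fL; have : \forall L \near +oo, 0 < L /\ forall p q, `|f p - f q| <= L * `|p - q|.
  near=> L; split; first by near: L; exact: nbhs_pinfty_gt.
  move=> p q; have : (L.-lipschitz f) by near: L.
  by move=> /(_ (p, q)); apply.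
by move=> /filter_ex[L [L0 LP]]; exists L.
Unshelve. all: by end_near.
Qed.

Lemma norm_pairB (x y x' y' : R) :
  `|((x, y) : R * R) - (x', y')| = Num.max `|x - x'| `|y - y'|.
Proof. by []. Qed.

Definition vstrip (x x' : R) : set (R * R) := [set p | x < p.1 <= x'].
Definition hstrip (x x' : R) : set (R * R) := [set p | x < p.2 <= x'].

Lemma measurable_fst_preimage (D : set R) : measurable D -> measurable [set p : R * R | D p.1].
Proof.
by move=> mD; rewrite -[X in measurable X]setTI; exact: (measurable_fst measurableT).
Qed.

Lemma measurable_snd_preimage (D : set R) : measurable D -> measurable [set p : R * R | D p.2].
Proof.
by move=> mD; rewrite -[X in measurable X]setTI; exact: (measurable_snd measurableT).
Qed.

Lemma measurable_vstrip x x' : measurable (vstrip x x').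
Proof.
rewrite (_ : vstrip x x' = [set p | `]x, x']%classic p.1]); first exact: measurable_fst_preimage.
by apply/seteqP; split => p; rewrite /= in_itv.
Qed.

Lemma measurable_hstrip x x' : measurable (hstrip x x').
Proof.
rewrite (_ : hstrip x x' = [set p | `]x, x']%classic p.2]); first exact: measurable_snd_preimage.
by apply/seteqP; split => p; rewrite /= in_itv.
Qed.

Lemma measurable_quadrant (x y : R) : measurable (`]-oo, x] `*` `]-oo, y] : set (R * R)).
Proof. by apply: measurableX; exact: measurable_itv. Qed.

(** The part of the strip below height n is a difference of two quadrants, with
    mass at most L (x' - x); let n tend to infinity. *)
Lemma vstrip_le F (L x x' : R) :
  (forall p q, `|cdf2 F p - cdf2 F q| <= L * `|p - q|) -> x <= x' ->
  fine (F (vstrip x x')) <= L * (x' - x).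
Proof.
move=> FL xx'.
pose S n : set (R * R) := (`]-oo, x'] `*` `]-oo, n%:R]) `\` (`]-oo, x] `*` `]-oo, n%:R]).
have SE n p : S n p <-> (x < p.1 <= x' /\ p.2 <= n%:R).
  rewrite /S /= !in_itv/=; split.
    by move=> [[-> ->] /not_andP[|//]] /negP; rewrite -ltNge => ->.
  by move=> [/andP[xp ->] ->]; split => // -[]; rewrite leNgt xp.
have -> : vstrip x x' = \bigcup_n S n.
  apply/seteqP; split => p.
    move=> xp; exists (Num.truncn `|p.2|).+1 => //; apply/SE; split => //.
    by apply: le_trans (ler_norm _) (ltW _); rewrite -truncn_le_nat.
  by move=> [n _ /SE[]].
apply: nondecreasing_union_le.
- by move=> n; apply: measurableD; exact: measurable_quadrant.
- move=> m n mn; apply/subsetPset => p /SE[xp pm]; apply/SE; split => //.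
  by apply: le_trans pm _; rewrite ler_nat.
- move=> n; rewrite /S measureD; [|exact: measurable_quadrant|exact: measurable_quadrant|].
    rewrite setIidr; last first.
      by move=> p [/= + ?]; rewrite !in_itv/= => px; split => //; exact: le_trans px xx'.
    rewrite fineB ?fin_num_measure//; do ?exact: measurable_quadrant.
    apply: le_trans (ler_norm _) _.
    have := FL (x', n%:R) (x, n%:R); rewrite norm_pairB subrr normr0.
    by rewrite max_l ?normr_ge0// [`|x' - x|]ger0_norm ?subr_ge0.
  by rewrite ltey_eq fin_num_measure//; exact: measurable_quadrant.
Qed.

Lemma hstrip_le F (L x x' : R) :
  (forall p q, `|cdf2 F p - cdf2 F q| <= L * `|p - q|) -> x <= x' ->
  fine (F (hstrip x x')) <= L * (x' - x).
Proof.
move=> FL xx'.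
pose S n : set (R * R) := (`]-oo, n%:R] `*` `]-oo, x']) `\` (`]-oo, n%:R] `*` `]-oo, x]).
have SE n p : S n p <-> (x < p.2 <= x' /\ p.1 <= n%:R).
  rewrite /S /= !in_itv/=; split.
    by move=> [[-> ->] /not_andP[//|]] /negP; rewrite -ltNge => ->.
  by move=> [/andP[xp ->] ->]; split => // -[_]; rewrite leNgt xp.
have -> : hstrip x x' = \bigcup_n S n.
  apply/seteqP; split => p.
    move=> xp; exists (Num.truncn `|p.1|).+1 => //; apply/SE; split => //.
    by apply: le_trans (ler_norm _) (ltW _); rewrite -truncn_le_nat.
  by move=> [n _ /SE[]].
apply: nondecreasing_union_le.
- by move=> n; apply: measurableD; exact: measurable_quadrant.
- move=> m n mn; apply/subsetPset => p /SE[xp pm]; apply/SE; split => //.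
  by apply: le_trans pm _; rewrite ler_nat.
- move=> n; rewrite /S measureD; [|exact: measurable_quadrant|exact: measurable_quadrant|].
    rewrite setIidr; last first.
      by move=> p [/= ?]; rewrite !in_itv/= => px; split => //; exact: le_trans px xx'.
    rewrite fineB ?fin_num_measure//; do ?exact: measurable_quadrant.
    apply: le_trans (ler_norm _) _.
    have := FL (n%:R, x') (n%:R, x); rewrite norm_pairB subrr normr0.
    by rewrite max_r ?normr_ge0// [`|x' - x|]ger0_norm ?subr_ge0.
  by rewrite ltey_eq fin_num_measure//; exact: measurable_quadrant.
Qed.

Lemma measurable_outside_square (c : R) :
  measurable [set p : R * R | c < Num.max `|p.1| `|p.2|].
Proof.
have mm : measurable_fun setT (fun p : R * R => Num.max `|p.1| `|p.2|).
  by apply: measurable_maxr; exact: measurableT_comp.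
have := mm measurableT _ (measurable_itv `]c, +oo[); rewrite setTI.
by congr measurable; apply/seteqP; split => p /=; rewrite in_itv/= andbT.
Qed.

Lemma tail_small F (e : R) : 0 < e -> \forall n \near \oo,
  fine (F [set p | n%:R < Num.max `|p.1| `|p.2|]) <= e.
Proof.
move=> e0; pose A n := [set p : R * R | n%:R < Num.max `|p.1| `|p.2|].
have mA n : measurable (A n) by exact: measurable_outside_square.
have A0 : \bigcap_n A n = set0.
  apply/seteqP; split => // p Ap.
  have := Ap (Num.truncn (Num.max `|p.1| `|p.2|)).+1 I.
  by rewrite /A /= ltNge => /negP; apply; apply/ltW; rewrite -truncn_le_nat.
have : F \o A @ \oo --> F (\bigcap_n A n).
  apply: nonincreasing_cvg_mu => //.
  - by rewrite ltey_eq fin_num_measure.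
  - exact: bigcap_measurable.
  - move=> m n mn; apply/subsetPset => p; apply: le_lt_trans; by rewrite ler_nat.
rewrite A0 measure0 => cv.
have : nbhs (0%E : \bar R) [set x : \bar R | (x < e%:E)%E].
  by apply: open_nbhs_nbhs; split; [exact: open_ereal_lt_ereal|rewrite /= lte_fin].
move/cv => near_small; near=> n.
have /ltW : (F (A n) < e%:E)%E by near: n; exact: near_small.
by rewrite -[leLHS]fineK ?fin_num_measure// lee_fin.
Unshelve. all: by end_near.
Qed.

End marginals.

(** The axis is cut at the points t 0 <= ... <= t (K - 1); the rank of x is the
    number of cut points strictly below x. *)
Section grid_rank.
Context {R : realType}.
Variables (K : nat) (t : nat -> R).

Definition grid_rank (x : R) : nat := \sum_(a < K) (t a < x)%R.

Lemma sum_ltn_minn (u : nat) : (\sum_(a < K) (a < u) = minn K u)%N.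
Proof.
elim: K => [|k IH]; first by rewrite big_ord0 min0n.
by rewrite big_ord_recr/= IH; lia.
Qed.

Lemma grid_rank_le x : (grid_rank x <= K)%N.
Proof.
rewrite /grid_rank -[leqRHS]card_ord -sum1_card.
by apply: leq_sum => a _; case: (t a < x).
Qed.

Lemma le_grid_rank x y : x <= y -> (grid_rank x <= grid_rank y)%N.
Proof.
move=> xy; apply: leq_sum => a _.
by case: ltP => // tx; rewrite (lt_le_trans tx xy).
Qed.

Lemma grid_rank_stable x y (e : R) : `|x - y| <= e ->
  (forall a, (a < K)%N -> ~ (t a - 2 * e < x <= t a + e)) ->
  grid_rank x = grid_rank y.
Proof.
move=> xy far; apply: eq_bigr => a _; congr nat_of_bool.
have := far _ (ltn_ord a); move: xy; rewrite ler_norml => /andP[xy1 xy2] /negP.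
rewrite negb_and -leNgt -ltNge => /orP[h|h]; apply/idP/idP => ?; lra.
Qed.

Hypothesis nd_t : {homo t : a b / (a <= b)%N >-> a <= b}.

Lemma grid_rank_leS x u : x <= t u -> (grid_rank x <= u)%N.
Proof.
move=> xt; apply: leq_trans (_ : (\sum_(a < K) (a < u) <= u)%N); last first.
  by rewrite sum_ltn_minn geq_minr.
apply: leq_sum => a _; have [_|ua] := ltnP a u; first by case: (t a < x).
by rewrite ltNge (le_trans xt)// nd_t.
Qed.

Lemma grid_rank_gt x u : (u < K)%N -> t u < x -> (u < grid_rank x)%N.
Proof.
move=> uK tx; apply: leq_trans (_ : (\sum_(a < K) (a < u.+1) <= _)%N).
  by rewrite sum_ltn_minn leq_min uK ltnSn.
apply: leq_sum => a _; have [au|//] := ltnP a u.+1.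
by rewrite (le_lt_trans _ tx)// nd_t.
Qed.

Lemma measurable_grid_rank u : measurable [set x | grid_rank x = u].
Proof.
have mg : measurable_fun setT (fun x : R =>
    \sum_(a <- index_enum 'I_K) (\1_(`]t a, +oo[%classic) x : R)).
  by apply: measurable_sum => a; exact: measurable_indic.
have := mg measurableT _ (measurable_set1 (u%:R : R)); rewrite setTI.
congr measurable; apply/seteqP; split => x /=;
  rewrite (_ : \sum_(a <- _) _ = (grid_rank x)%:R).
- by move/eqP; rewrite eqr_nat => /eqP.
- by rewrite natr_sum; apply: eq_bigr => a _; rewrite indicE mem_setE in_itv/= andbT.
- by move=> ->.
- by rewrite natr_sum; apply: eq_bigr => a _; rewrite indicE mem_setE in_itv/= andbT.
Qed.

Variables (F : probability (R * R)%type R) (L : R).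
Hypothesis L0 : 0 < L.
Hypothesis FL : forall p q, `|cdf2 F p - cdf2 F q| <= L * `|p - q|.

(** Only points within distance e of one of the K lines in either direction can
    change their cell by moving by e; the strips around these lines have width
    3 e and total mass at most 6 L e K. *)
Lemma cell_continuity_set (u v : nat) :
  continuity_set F [set p | grid_rank p.1 = u /\ grid_rank p.2 = v].
Proof.
move=> eps eps0.
pose e := eps / (6 * L * K.+1%:R).
have K0 : 0 < K.+1%:R :> R by [].
have e0 : 0 < e by rewrite divr_gt0// !mulr_gt0.
pose E a := vstrip (t a - 2 * e) (t a + e) `|` hstrip (t a - 2 * e) (t a + e).
have [|B [mB PB EB]] := @union_bound _ _ _ F _ (iota 0 K) E (6 * L * e).
  move=> a _; have mv := measurable_vstrip (t a - 2 * e) (t a + e).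
  have mh := measurable_hstrip (t a - 2 * e) (t a + e).
  split; first exact: measurableU.
  rewrite -[leLHS]fineK ?fin_num_measure ?lee_fin//; last exact: measurableU.
  apply: le_trans (fine_probabilityU _ mv mh) _.
  have tt : t a - 2 * e <= t a + e by lra.
  have := vstrip_le FL tt; have := hstrip_le FL tt.
  have -> : t a + e - (t a - 2 * e) = 3 * e by lra.
  by lra.
exists e, B; split => //.
  rewrite -lee_fin fineK ?fin_num_measure//; apply: le_trans PB _.
  rewrite lee_fin size_iota /e.
  rewrite [leLHS](_ : _ = eps * (K%:R / K.+1%:R)); last first.
    by field; rewrite !gt_eqF.
  by rewrite ger_pMr// ler_pdivrMr// mul1r ler_nat.
move=> p p' pp' nB; rewrite /norm1/= in pp'.
have [p1 p2] : `|p.1 - p'.1| <= e /\ `|p.2 - p'.2| <= e.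
  by split; apply: le_trans pp'; rewrite ?lerDl ?lerDr.
have r1 : grid_rank p.1 = grid_rank p'.1.
  apply: (grid_rank_stable p1) => a aK h; apply: nB; apply: (EB a).
    by rewrite mem_iota.
  by left.
have r2 : grid_rank p.2 = grid_rank p'.2.
  apply: (grid_rank_stable p2) => a aK h; apply: nB; apply: (EB a).
    by rewrite mem_iota.
  by right.
by rewrite /= r1 r2.
Qed.

Variables (h M : R).
Hypothesis tS : forall a, t a.+1 = t a + h.
Hypothesis h0 : 0 <= h.
Hypothesis K0 : (0 < K)%N.
Hypothesis tlo : t 0%N < - M.
Hypothesis thi : M <= t K.-1.
Hypothesis tail : fine (F [set p | M < Num.max `|p.1| `|p.2|]) <= L * h.

(** A fiber of the rank is an interval between consecutive cut points, except
    for the two unbounded ones, which lie outside [-M, M]. *)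
Lemma grid_rank_fiber u x : grid_rank x = u -> M < `|x| \/ t u.-1 < x <= t u.-1 + h.
Proof.
move=> xu; have [xM|xM] := ltP M `|x|; [by left|right].
move: xM; rewrite ler_norml => /andP[Mx xM].
have u0 : (0 < u)%N.
  rewrite lt0n; apply/eqP => u0; have : t 0 < x by exact: lt_le_trans tlo Mx.
  by move=> /(grid_rank_gt K0); rewrite xu u0.
have uK : (u < K)%N.
  rewrite ltn_neqAle -{2}xu grid_rank_le andbT; apply/eqP => uK.
  have /grid_rank_leS : x <= t K.-1 by exact: le_trans thi.
  by rewrite xu uK; case: (K) K0 => // k _; rewrite ltnn.
apply/andP; split.
  rewrite ltNge; apply/negP => /grid_rank_leS.
  by rewrite xu; case: (u) u0 => // k _; rewrite ltnn.
rewrite -tS prednK// leNgt; apply/negP => /(grid_rank_gt uK).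
by rewrite xu ltnn.
Qed.

Lemma vfiber_le u : fine (F [set p | grid_rank p.1 = u]) <= 2 * (L * h).
Proof.
have mv := measurable_vstrip (t u.-1) (t u.-1 + h).
apply: le_trans (fine_probability_approx (B := vstrip (t u.-1) (t u.-1 + h))
  (E := [set p | M < Num.max `|p.1| `|p.2|]) F _ mv (measurable_outside_square M) _) _.
- exact: (measurable_fst_preimage (measurable_grid_rank u)).
- move=> p /grid_rank_fiber[Mp|]; [right|by left].
  by rewrite /= lt_max Mp.
rewrite mulr2n mulrDl mul1r; apply: lerD => //.
have tt : t u.-1 <= t u.-1 + h by rewrite lerDl.
by apply: le_trans (vstrip_le FL tt) _; rewrite [_ + h]addrC addrK.
Qed.

Lemma hfiber_le u : fine (F [set p | grid_rank p.2 = u]) <= 2 * (L * h).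
Proof.
have mv := measurable_hstrip (t u.-1) (t u.-1 + h).
apply: le_trans (fine_probability_approx (B := hstrip (t u.-1) (t u.-1 + h))
  (E := [set p | M < Num.max `|p.1| `|p.2|]) F _ mv (measurable_outside_square M) _) _.
- exact: (measurable_snd_preimage (measurable_grid_rank u)).
- move=> p /grid_rank_fiber[Mp|]; [right|by left].
  by rewrite /= lt_max Mp orbT.
rewrite mulr2n mulrDl mul1r; apply: lerD => //.
have tt : t u.-1 <= t u.-1 + h by rewrite lerDl.
by apply: le_trans (hstrip_le FL tt) _; rewrite [_ + h]addrC addrK.
Qed.

End grid_rank.

Section grid.
Context {R : realType}.
Variables F G : probability (R * R)%type R.

(** The properties of a grid that are used later: the rank is monotone, every
    strip has mass at most eps under both laws, and the cells have null
    boundary. *)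
Record fine_grid (eps : R) (K : nat) (rk : R -> 'I_K) : Prop := FineGrid {
  grid_homo : forall x y, x <= y -> (rk x <= rk y)%N ;
  grid_measurable : forall u, measurable [set x | rk x = u] ;
  grid_vsmall : forall H, H = F \/ H = G -> forall u,
    fine (H [set p | rk p.1 = u]) <= eps ;
  grid_hsmall : forall H, H = F \/ H = G -> forall u,
    fine (H [set p | rk p.2 = u]) <= eps ;
  grid_continuity : forall H, H = F \/ H = G -> forall u v,
    continuity_set H [set p | rk p.1 = u /\ rk p.2 = v] }.

Lemma fine_grid_exists (eps : R) : lipschitz (cdf2 F) -> lipschitz (cdf2 G) ->
  0 < eps -> exists K (rk : R -> 'I_K), fine_grid eps rk.
Proof.
move=> /lipschitz_bound[LF LF0 FLF] /lipschitz_bound[LG LG0 GLG] eps0.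
pose L := LF + LG.
have L0 : 0 < L by rewrite addr_gt0.
have FL p q : `|cdf2 F p - cdf2 F q| <= L * `|p - q|.
  by apply: le_trans (FLF p q) _; rewrite ler_wpM2r// lerDl ltW.
have GL p q : `|cdf2 G p - cdf2 G q| <= L * `|p - q|.
  by apply: le_trans (GLG p q) _; rewrite ler_wpM2r// lerDr ltW.
(* Mesh h and half-width M are such that a strip inside the square and the
   complement of the square both have mass at most L h = eps / 2. *)
pose h := eps / (2 * L).
have h0 : 0 < h by rewrite divr_gt0// mulr_gt0.
have Lh : 2 * (L * h) = eps by rewrite /h; field; rewrite gt_eqF.
have Lh0 : 0 < L * h by rewrite mulr_gt0.
have [m [tF tG]] : exists m : nat,
    fine (F [set p | m%:R < Num.max `|p.1| `|p.2|]) <= L * h /\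
    fine (G [set p | m%:R < Num.max `|p.1| `|p.2|]) <= L * h.
  near \oo => m; exists m; split; near: m; exact: tail_small.
pose M : R := m%:R.
(* The first cut point is strictly to the left of -M, so that rank 0 forces
   |x| > M. *)
pose t (a : nat) := - M - h + a%:R * h.
have tS a : t a.+1 = t a + h by rewrite /t -natr1; ring.
have nd_t : {homo t : a b / (a <= b)%N >-> a <= b}.
  by move=> x y xy; rewrite /t lerD2l ler_wpM2r ?ler_nat// ltW.
pose K := (Num.truncn (2 * M / h)).+3.
have thi : M <= t K.-1.
  have : 2 * M / h < (Num.truncn (2 * M / h)).+1%:R by rewrite -truncn_le_nat.
  rewrite ltr_pdivrMr// /t /K/= -[_.+2%:R]natr1; lra.
have tlo : t 0 < - M by rewrite /t mul0r; lra.
pose rk x : 'I_K.+1 := Ordinal (grid_rank_le K t x : (grid_rank K t x < K.+1)%N).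
have rkE x (u : 'I_K.+1) : rk x = u <-> grid_rank K t x = u.
  by split=> [<-//|xu]; apply/val_inj.
have HL H : H = F \/ H = G -> forall p q, `|cdf2 H p - cdf2 H q| <= L * `|p - q|.
  by move=> [] ->.
have Htail H : H = F \/ H = G -> fine (H [set p | M < Num.max `|p.1| `|p.2|]) <= L * h.
  by move=> [] ->.
exists K.+1, rk; split.
- by move=> x y xy; exact: le_grid_rank.
- move=> u; under eq_set do rewrite (propext (rkE _ _)).
  exact: measurable_grid_rank.
- move=> H HFG u; under eq_set do rewrite (propext (rkE _ _)).
  by rewrite -Lh; exact: (vfiber_le nd_t (HL H HFG) tS (ltW h0) _ tlo thi (Htail H HFG)).
- move=> H HFG u; under eq_set do rewrite (propext (rkE _ _)).
  by rewrite -Lh; exact: (hfiber_le nd_t (HL H HFG) tS (ltW h0) _ tlo thi (Htail H HFG)).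
- move=> H HFG u v; under eq_set do rewrite !(propext (rkE _ _)).
  exact: (cell_continuity_set K t L0 (HL H HFG)).
Unshelve. all: by end_near.
Qed.

End grid.

(** * Discretisation of the Kendall kernel *)

Section finite_valued.
Context {R : realType} {d : measure_display} {T : measurableType d}.
Variables (P : probability T R) (I : finType) (cell : T -> I).
Hypothesis mcell : forall A, measurable [set x | cell x = A].

Lemma finite_valuedE (f : I -> R) x :
  f (cell x) = \sum_(A <- index_enum I) f A * \1_[set x | cell x = A] x.
Proof.
rewrite (bigD1 (cell x))//= big1 ?addr0; last first.
  by move=> A Ax; rewrite indicE memNset ?mulr0//= => xA; rewrite xA eqxx in Ax.
by rewrite indicE mem_set ?mulr1.
Qed.

Lemma integrable_finite_valued (f : I -> R) : P.-integrable setT (EFin \o (f \o cell)).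
Proof.
rewrite (_ : f \o cell = fun x =>
  \sum_(A <- index_enum I) f A * \1_[set x | cell x = A] x); last first.
  by apply/funext => x /=; rewrite finite_valuedE.
by apply: integrable_sumR => A; exact: integrable_scaled_indic.
Qed.

Lemma Rintegral_finite_valued (f : I -> R) :
  \int[P]_x f (cell x) = \sum_A f A * fine (P [set x | cell x = A]).
Proof.
under eq_Rintegral do rewrite finite_valuedE.
rewrite Rintegral_sum; last by move=> A; exact: integrable_scaled_indic.
by apply: eq_bigr => A _; rewrite Rintegral_scaled_indic.
Qed.

Lemma sum_cell_probability (Q : pred I) :
  \sum_(A | Q A) fine (P [set x | cell x = A]) = fine (P [set x | Q (cell x)]).
Proof.
have mQ : measurable [set x | Q (cell x)].
  rewrite (_ : [set x | Q (cell x)] = \big[setU/set0]_(A | Q A) [set x | cell x = A]).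
    exact: bigsetU_measurable.
  apply/seteqP; split => x /=; rewrite -bigcup_seq_cond.
    by move=> Qx; exists (cell x) => //=; rewrite mem_index_enum.
  by move=> [A /= /andP[_ QA] ->].
rewrite -[RHS]mul1r -Rintegral_scaled_indic//.
transitivity (\int[P]_x ((Q (cell x))%:R : R)).
  rewrite (Rintegral_finite_valued (fun A => (Q A)%:R)) big_mkcond/=.
  by apply: eq_bigr => A _; case: (Q A); rewrite ?mul1r ?mul0r.
apply: eq_Rintegral => x _; rewrite mul1r indicE; congr (nat_of_bool _)%:R.
by apply/idP/idP => [Qx|/set_mem]//; rewrite mem_set.
Qed.

End finite_valued.

Section discretisation.
Context {R : realType}.

Lemma kendall_kernelE (p q : R * R) :
  kendall_kernel p q = Num.sg (q.1 - p.1) * Num.sg (q.2 - p.2).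
Proof.
rewrite -sgrM /kendall_kernel !indicE !mem_setE !in_itv/= andbT.
by case: sgrP => _; rewrite ?subrr ?subr0 ?sub0r.
Qed.

Lemma kendall_kernel_norm_le1 (p q : R * R) : `|kendall_kernel p q| <= 1.
Proof.
by rewrite kendall_kernelE normrM !normr_sg; do 2!case: (_ != _);
  rewrite ?mulr0 ?mul0r ?mulr1.
Qed.

Lemma kendall_kernelC (p q : R * R) : kendall_kernel p q = kendall_kernel q p.
Proof.
by rewrite !kendall_kernelE -opprB sgrN -[q.2 - _]opprB sgrN mulrNN.
Qed.

Lemma kendall_kernelxx (p : R * R) : kendall_kernel p p = 0.
Proof. by rewrite kendall_kernelE subrr sgr0 mul0r. Qed.

Lemma measurable_kendall_kernel :
  measurable_fun setT (fun z : (R * R) * (R * R) => kendall_kernel z.1 z.2).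
Proof.
have mprod : measurable_fun setT (fun z : (R * R) * (R * R) =>
    (z.2.1 - z.1.1) * (z.2.2 - z.1.2)).
  have m1 : measurable_fun setT (fun z : (R * R) * (R * R) => z.1) by exact: measurable_fst.
  have m2 : measurable_fun setT (fun z : (R * R) * (R * R) => z.2) by exact: measurable_snd.
  by apply: measurable_funM; apply: measurable_funB;
    [apply: (measurableT_comp measurable_fst) m2|
     apply: (measurableT_comp measurable_fst) m1|
     apply: (measurableT_comp measurable_snd) m2|
     apply: (measurableT_comp measurable_snd) m1].
rewrite /kendall_kernel; apply: measurable_funB.
  by apply: measurableT_comp mprod; apply: measurable_indic; exact: measurable_itv.
by apply: measurableT_comp mprod; apply: measurable_indic; exact: measurable_itv.
Qed.

Lemma integrable_kendall_kernel (Q : probability ((R * R) * (R * R))%type R) :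
  Q.-integrable setT (EFin \o (fun z => kendall_kernel z.1 z.2)).
Proof.
apply: measurable_bounded_integrable => //.
- by rewrite ltey_eq fin_num_measure.
- exact: measurable_kendall_kernel.
- exists 1; split => // x x1 z _.
  by apply: le_trans (kendall_kernel_norm_le1 _ _) (ltW x1).
Qed.

Variables (K : nat) (rk : R -> 'I_K).
Implicit Types A B : 'I_K * 'I_K.

Definition cell (p : R * R) : 'I_K * 'I_K := (rk p.1, rk p.2).

(** The Kendall kernel evaluated at the ranks of the two points. *)
Definition rank_kernel A B : R :=
  Num.sg (B.1%:R - A.1%:R) * Num.sg (B.2%:R - A.2%:R).

Definition collision A B : R := (A.1 == B.1)%:R + (A.2 == B.2)%:R.

Lemma collision_ge0 A B : 0 <= collision A B.
Proof. by rewrite addr_ge0. Qed.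

Lemma collision_le2 A B : collision A B <= 2.
Proof. by rewrite /collision; do 2!case: (_ == _); rewrite /=; lra. Qed.

Lemma rank_kernel_norm_le1 A B : `|rank_kernel A B| <= 1.
Proof.
by rewrite normrM !normr_sg; do 2!case: (_ != _); rewrite ?mulr0 ?mul0r ?mulr1.
Qed.

Hypothesis homo_rk : forall x y, x <= y -> (rk x <= rk y)%N.

Lemma sg_rk x y : rk x != rk y -> Num.sg (y - x) = Num.sg ((rk y)%:R - (rk x)%:R : R).
Proof.
move=> rxy; have [xy|yx|xy] := ltgtP x y.
- have : (rk x < rk y)%N by rewrite ltn_neqAle rxy homo_rk// ltW.
  by rewrite -(ltr_nat R) => ?; rewrite !gtr0_sg ?subr_gt0.
- have : (rk y < rk x)%N by rewrite ltn_neqAle eq_sym rxy homo_rk// ltW.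
  by rewrite -(ltr_nat R) => ?; rewrite !ltr0_sg ?subr_lt0.
- by rewrite xy eqxx in rxy.
Qed.

(** If two points differ in both ranks, the signs of the coordinate differences
    are those of the rank differences.  Otherwise the discretised kernel is 0,
    and the kernel is bounded by 1. *)
Lemma kendall_kernel_approx (p q : R * R) :
  `|kendall_kernel p q - rank_kernel (cell p) (cell q)| <= collision (cell p) (cell q).
Proof.
rewrite /collision /=.
have [e1|n1] := eqVneq (rk p.1) (rk q.1).
  rewrite /rank_kernel /= e1 subrr sgr0 mul0r subr0.
  by apply: le_trans (kendall_kernel_norm_le1 _ _) _; rewrite lerDl.
have [e2|n2] := eqVneq (rk p.2) (rk q.2).
  rewrite /rank_kernel /= e2 subrr sgr0 mulr0 subr0.
  by apply: le_trans (kendall_kernel_norm_le1 _ _) _; rewrite lerDr.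
by rewrite kendall_kernelE /rank_kernel /= (sg_rk n1) (sg_rk n2) subrr normr0 addr0.
Qed.

Hypothesis measurable_rk : forall u, measurable [set x | rk x = u].

Lemma cell_eqE A : [set p | cell p = A] = [set p | rk p.1 = A.1 /\ rk p.2 = A.2].
Proof. by apply/seteqP; split => p /=; case: A => u v /=; [case|case=> <- <-]. Qed.

Lemma measurable_cell A : measurable [set p | cell p = A].
Proof.
rewrite cell_eqE; apply: measurableI.
  exact: (measurable_fst_preimage (measurable_rk A.1)).
exact: (measurable_snd_preimage (measurable_rk A.2)).
Qed.

Definition cell_mass (H : probability (R * R)%type R) A : R :=
  fine (H [set p | cell p = A]).

Lemma cell_mass_ge0 H A : 0 <= cell_mass H A.
Proof. exact: fine_ge0. Qed.

Lemma sum_cell_mass H : \sum_A cell_mass H A = 1.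
Proof.
rewrite (sum_cell_probability H measurable_cell predT).
rewrite (_ : [set x | _] = setT); first by rewrite probability_setT.
by apply/seteqP; split.
Qed.

Section two_laws.
Variables (F G : probability (R * R)%type R).

Let cell2 (z : (R * R) * (R * R)) := (cell z.1, cell z.2).

Lemma measurable_cell2 AB : measurable [set z | cell2 z = AB].
Proof.
rewrite (_ : [set z | _] = [set p | cell p = AB.1] `*` [set p | cell p = AB.2]).
  by apply: measurableX; exact: measurable_cell.
by apply/seteqP; split => z /=; case: AB => A B /=; [case|case=> <- <-].
Qed.

Lemma Rintegral_cell2 (f : 'I_K * 'I_K -> 'I_K * 'I_K -> R) :
  \int[(F \x G)%E]_z f (cell z.1) (cell z.2) =
  \sum_A \sum_B f A B * (cell_mass F A * cell_mass G B).
Proof.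
rewrite (Rintegral_finite_valued (F \x G)%E measurable_cell2 (fun AB => f AB.1 AB.2)).
rewrite pair_big/=; apply: eq_bigr => -[A B] _ /=; congr (_ * _).
rewrite (_ : [set z | _] = [set p | cell p = A] `*` [set p | cell p = B]); last first.
  by apply/seteqP; split => z /=; [case|case=> <- <-].
rewrite [X in fine X]product_measure1E; [|exact: measurable_cell|exact: measurable_cell].
rewrite fineM ?fin_num_measure//; exact: measurable_cell.
Qed.

(** kendall_kernel_approx, integrated with respect to the product law; the
    integrals of the discretised functions are finite sums of products of cell
    masses. *)
Lemma cross_tau_approx :
  `|cross_tau F G - \sum_A \sum_B rank_kernel A B * (cell_mass F A * cell_mass G B)| <=
  \sum_A \sum_B collision A B * (cell_mass F A * cell_mass G B).
Proof.
pose Q := [the probability _ R of (F \x G)%E].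
have ik := integrable_kendall_kernel Q.
have ir f : Q.-integrable setT (EFin \o (fun z => f (cell z.1) (cell z.2))).
  exact: (integrable_finite_valued Q measurable_cell2 (fun AB => f AB.1 AB.2)).
rewrite -!Rintegral_cell2 /cross_tau -(RintegralB _ ik (ir rank_kernel))//.
have id : Q.-integrable setT (EFin \o
    (fun z => kendall_kernel z.1 z.2 - rank_kernel (cell z.1) (cell z.2))).
  rewrite (_ : _ \o _ = (EFin \o (fun z => kendall_kernel z.1 z.2)) \-
    (EFin \o (fun z => rank_kernel (cell z.1) (cell z.2))))%E//.
  exact: integrableB.
apply: le_trans (le_normr_Rintegral _ id) _ => //.
apply: le_Rintegral => //.
- exact: integrable_norm.
- by move=> z _; exact: kendall_kernel_approx.
Qed.

(** Given the first point, the second one has to fall in the vertical or in the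
    horizontal strip of the first one. *)
Lemma collision_mass_le (eps : R) :
  (forall u, fine (G [set p | rk p.1 = u]) <= eps) ->
  (forall u, fine (G [set p | rk p.2 = u]) <= eps) ->
  \sum_A \sum_B collision A B * (cell_mass F A * cell_mass G B) <= 2 * eps.
Proof.
move=> vs hs.
have -> : 2 * eps = (\sum_A cell_mass F A) * (2 * eps) by rewrite sum_cell_mass mul1r.
rewrite mulr_suml; apply: ler_sum => A _.
under eq_bigr do rewrite mulrCA.
rewrite -mulr_sumr ler_wpM2l ?cell_mass_ge0//.
under eq_bigr do rewrite mulrDl.
rewrite big_split/= mulr2n mulrDl mul1r.
have sumE (Q : pred ('I_K * 'I_K)) :
    \sum_B (Q B)%:R * cell_mass G B = fine (G [set p | Q (cell p)]).
  rewrite -(sum_cell_probability G measurable_cell Q) [RHS]big_mkcond/=.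
  by apply: eq_bigr => B _; case: (Q B); rewrite ?mul1r ?mul0r.
apply: lerD.
  rewrite (sumE (fun B => A.1 == B.1)); apply: le_trans (vs A.1).
  rewrite le_eqVlt; apply/orP; left; apply/eqP; congr (fine (G _)).
  by apply/seteqP; split => p /=; [move/eqP|move=> ->].
rewrite (sumE (fun B => A.2 == B.2)); apply: le_trans (hs A.2).
rewrite le_eqVlt; apply/orP; left; apply/eqP; congr (fine (G _)).
by apply/seteqP; split => p /=; [move/eqP|move=> ->].
Qed.

End two_laws.
End discretisation.

(** * From cell counts to pair sums *)

Section bilinear.
Context {R : realType} {I : finType}.
Implicit Types (x p : nat -> I -> R) (f : I -> I -> R).

Definition bilin f (u v : I -> R) : R := \sum_A \sum_B f A B * (u A * v B).

Lemma bilin_sum f x (s : seq nat) :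
  \sum_(i <- s) \sum_(j <- s) bilin f (x i) (x j) =
  bilin f (fun A => \sum_(i <- s) x i A) (fun A => \sum_(i <- s) x i A).
Proof.
rewrite /bilin; under eq_bigr do rewrite exchange_big/=.
rewrite exchange_big/=; apply: eq_bigr => A _.
under eq_bigr do rewrite exchange_big/=.
rewrite exchange_big/=; apply: eq_bigr => B _.
under eq_bigr do rewrite -!mulr_sumr.
by rewrite -mulr_sumr -mulr_suml.
Qed.

Lemma bilin_dirac f A B :
  bilin f (fun A' => (A == A')%:R) (fun B' => (B == B')%:R) = f A B.
Proof.
rewrite /bilin (bigD1 A)//= [X in _ + X]big1 ?addr0; last first.
  by move=> A' AA'; rewrite big1// => B' _; rewrite eq_sym (negbTE AA') mul0r mulr0.
rewrite (bigD1 B)//= [X in _ + X]big1 ?addr0; last first.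
  by move=> B' BB'; rewrite [B == _]eq_sym (negbTE BB') !mulr0.
by rewrite !eqxx !mulr1.
Qed.

(** The identity u A * u B - v A * v B = (u A - v A) u B + v A (u B - v B),
    summed over all pairs of cells. *)
Lemma bilin_perturb f (u v : I -> R) (c m e : R) :
  (forall A B, `|f A B| <= c) ->
  (forall A, 0 <= u A <= m) -> (forall A, 0 <= v A <= m) ->
  (forall A, `|u A - v A| <= e) ->
  `|bilin f u u - bilin f v v| <= #|I|%:R ^+ 2 * (c * (2 * (m * e))).
Proof.
move=> fc um vm uv.
have sumI (z : R) : \sum_(A : I) \sum_(B : I) z = #|I|%:R ^+ 2 * z.
  by rewrite !sumr_const -[LHS]mulr_natl -[z *+ _]mulr_natl mulrA expr2.
rewrite -sumI /bilin -sumrB; apply: le_trans (ler_norm_sum _ _ _) _.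
apply: ler_sum => A _; rewrite -sumrB; apply: le_trans (ler_norm_sum _ _ _) _.
apply: ler_sum => B _; rewrite -mulrBr normrM; apply: ler_pM => //.
have -> : u A * u B - v A * v B = (u A - v A) * u B + v A * (u B - v B) by ring.
apply: le_trans (ler_normD _ _) _; rewrite !normrM mulr2n mulrDl mul1r.
have /andP[u0 u1] := um B; have /andP[v0 v1] := vm A.
apply: lerD; first by rewrite mulrC ler_pM// ger0_norm.
by rewrite ler_pM// ger0_norm.
Qed.

End bilinear.

Section empirical_kendall.
Variables (R : realType) (lam : R) (F G : probability (R * R)%type R).
Variables (eps : R) (K : nat) (rk : R -> 'I_K).
Hypothesis rkP : fine_grid F G eps rk.
Let law := regime_law lam F G.
Let mcell A := measurable_cell (grid_measurable rkP) A.

Lemma regime_lawP n i : law n i = F \/ law n i = G.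
Proof. by rewrite /law /regime_law; case: ifP; [left|right]. Qed.

(** Three errors are added: the kernel against its discretisation along the
    sample, the cell counts against their means in the quadratic form of the
    discretised kernel, and the discretisation against cross_tau.  The first one
    is itself a quadratic form in the cell counts, with the collision kernel,
    and is compared with its mean in the same way. *)
Lemma pair_sum_approx (w : nat -> R * R) (n k : nat) (eta : R) : (k <= n)%N ->
  (forall A, `|\sum_(1 <= i < k.+1)
      (\1_[set p | cell rk p = A] (w i) - cell_mass rk (law n i) A)| <= eta * n%:R) ->
  `|\sum_(1 <= i < k.+1) \sum_(1 <= j < k.+1)
     (kendall_kernel (w i) (w j) - cross_tau (law n i) (law n j))| <=
  (4 * eps + 6 * #|{: 'I_K * 'I_K}|%:R ^+ 2 * eta) * n%:R ^+ 2.
Proof.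
move=> kn dev.
pose x i (A : 'I_K * 'I_K) : R := (cell rk (w i) == A)%:R.
pose p i A := cell_mass rk (law n i) A.
pose s := index_iota 1 k.+1.
pose X A := \sum_(i <- s) x i A; pose Pp A := \sum_(i <- s) p i A.
have xE i A : \1_[set p | cell rk p = A] (w i) = x i A.
  by rewrite indicE /x; congr (nat_of_bool _)%:R; apply/idP/eqP => [/set_mem|/mem_set].
have size_s : \sum_(i <- s) (1 : R) = k%:R by rewrite sumr_const_nat subn1.
have kn' : k%:R <= n%:R :> R by rewrite ler_nat.
have n0 : 0 <= n%:R :> R by [].
have XPdev A : `|X A - Pp A| <= eta * n%:R.
  rewrite /X /Pp -sumrB; apply: le_trans (dev A).
  by under eq_bigr do rewrite -xE.
have Xb A : 0 <= X A <= n%:R.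
  rewrite sumr_ge0//= (le_trans _ kn')// -size_s; apply: ler_sum => i _.
  by rewrite /x; case: (_ == _).
have Pb A : 0 <= Pp A <= n%:R.
  rewrite sumr_ge0//=; last by move=> i _; exact: cell_mass_ge0.
  rewrite (le_trans _ kn')// -size_s; apply: ler_sum => i _.
  by have /andP[] := fine_probability_bounds (law n i) (mcell A).
pose N2 : R := #|{: 'I_K * 'I_K}|%:R ^+ 2.
have pert f c : (forall A B, `|f A B| <= c) ->
    `|bilin f X X - bilin f Pp Pp| <= N2 * (c * (2 * (n%:R * (eta * n%:R)))).
  by move=> fc; exact: bilin_perturb.
have kern := pert _ _ (@rank_kernel_norm_le1 R K).
have coll : `|bilin (@collision R K) X X - bilin (@collision R K) Pp Pp| <=
    N2 * (2 * (2 * (n%:R * (eta * n%:R)))).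
  by apply: pert => A B; rewrite ger0_norm ?collision_ge0 ?collision_le2.
have collP i j : bilin (@collision R K) (p i) (p j) <= 2 * eps.
  by apply: (collision_mass_le (grid_measurable rkP)) => u;
    [apply: (grid_vsmall rkP)|apply: (grid_hsmall rkP)]; exact: regime_lawP.
have sum_le (f : nat -> R) c : (forall i, f i <= c) -> \sum_(i <- s) f i <= k%:R * c.
  move=> fc; rewrite -size_s mulr_suml; apply: ler_sum => i _; by rewrite mul1r.
have sum2_le (f : nat -> nat -> R) c : (forall i j, f i j <= c) -> 0 <= c ->
    \sum_(i <- s) \sum_(j <- s) f i j <= n%:R ^+ 2 * c.
  move=> fc c0; apply: le_trans (sum_le _ (k%:R * c) _) _ => [i|]; first exact: sum_le.
  by rewrite mulrA ler_wpM2r// expr2 ler_pM.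
have eps0 : 0 <= 2 * eps.
  by rewrite mulr_ge0// (le_trans _ (grid_vsmall rkP (or_introl erefl) (rk 0)))// fine_ge0.
(* A double sum of functions of cells is the quadratic form at the cell counts,
   since each observation contributes a point mass to X. *)
have cE (f : 'I_K * 'I_K -> 'I_K * 'I_K -> R) :
    \sum_(i <- s) \sum_(j <- s) f (cell rk (w i)) (cell rk (w j)) = bilin f X X.
  rewrite -bilin_sum; apply: eq_bigr => i _; apply: eq_bigr => j _.
  by rewrite bilin_dirac.
pose g i j := kendall_kernel (w i) (w j).
pose th i j := cross_tau (law n i) (law n j).
pose rkn := @rank_kernel R K.
have S1 : `|\sum_(i <- s) \sum_(j <- s) (g i j - rkn (cell rk (w i)) (cell rk (w j)))| <=
    n%:R ^+ 2 * (2 * eps) + N2 * (2 * (2 * (n%:R * (eta * n%:R)))).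
  apply: (@le_trans _ _ (bilin (@collision R K) X X)).
    rewrite -cE; apply: le_trans (ler_norm_sum _ _ _) _; apply: ler_sum => i _.
    apply: le_trans (ler_norm_sum _ _ _) _; apply: ler_sum => j _.
    exact: (kendall_kernel_approx (grid_homo rkP)).
  have PP : bilin (@collision R K) Pp Pp <= n%:R ^+ 2 * (2 * eps).
    by rewrite -bilin_sum; apply: sum2_le.
  have := le_trans (ler_norm _) coll; lra.
have S3 : `|\sum_(i <- s) \sum_(j <- s) (th i j - bilin rkn (p i) (p j))| <=
    n%:R ^+ 2 * (2 * eps).
  apply: le_trans (ler_norm_sum _ _ _) _.
  apply: (@le_trans _ _ (\sum_(i <- s) \sum_(j <- s) `|th i j - bilin rkn (p i) (p j)|)).
    by apply: ler_sum => i _; exact: ler_norm_sum.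
  apply: sum2_le => // i j; apply: le_trans (collP i j).
  exact: (cross_tau_approx (grid_homo rkP) (grid_measurable rkP)).
rewrite [X in `|X|](_ : _ =
  (\sum_(i <- s) \sum_(j <- s) (g i j - rkn (cell rk (w i)) (cell rk (w j)))) +
  (bilin rkn X X - bilin rkn Pp Pp) -
  (\sum_(i <- s) \sum_(j <- s) (th i j - bilin rkn (p i) (p j)))); last first.
  rewrite -cE -[bilin rkn Pp Pp]bilin_sum -!sumrB -big_split/= -sumrB.
  apply: eq_bigr => i _; rewrite -!sumrB -big_split/= -sumrB.
  by apply: eq_bigr => j _; rewrite /g /th; ring.
apply: le_trans (ler_normB _ _) _.
apply: (@le_trans _ _ (n%:R ^+ 2 * (2 * eps) + N2 * (2 * (2 * (n%:R * (eta * n%:R)))) +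
  N2 * (1 * (2 * (n%:R * (eta * n%:R)))) + n%:R ^+ 2 * (2 * eps))).
  by apply: lerD S3; apply: le_trans (ler_normD _ _) _; apply: lerD kern.
by rewrite le_eqVlt; apply/orP; left; apply/eqP; rewrite /N2; ring.
Qed.

End empirical_kendall.

(** * The limit profile and its maximum *)

Section limit_profile.
Context {R : realType}.
Variables (A B D l : R).

(** Of the first s n observations, a = min s l (in units of n) come before the
    change and b = s - a after it; pairs contribute A within the first group,
    D within the second and B across the groups. *)
Definition pair_limit (l s : R) : R :=
  Num.min s l ^+ 2 * A + 2 * (Num.min s l * (s - Num.min s l)) * B
  + (s - Num.min s l) ^+ 2 * D.

(** Limit of (k / n) |tau_k - tau_n| for k / n -> s, since tau_k tends to
    pair_limit l s / s^2. *)
Definition profile (s : R) : R := `|pair_limit l s / s - s * pair_limit l 1|.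

Hypothesis l01 : 0 < l < 1.
Hypothesis AD : A != D.
Let rho := (B - A) / (D - A).
Hypothesis rho_lb : (1 - l) ^+ 2 / (2 * ((1 - l) ^+ 2 + l)) <= rho.
Hypothesis rho_ub : rho < 1.
(** The limit of tau_n after the affine change of scale that maps A to 0 and D
    to 1. *)
Let tau1 := (1 - l) * (2 * l * rho + 1 - l).

Let l0 : 0 < l. Proof. by case/andP: l01. Qed.
Let l1 : l < 1. Proof. by case/andP: l01. Qed.
Let DA0 : D - A != 0. Proof. by rewrite subr_eq0 eq_sym. Qed.

Let rho_lb' : (1 - l) ^+ 2 <= 2 * rho * ((1 - l) ^+ 2 + l).
Proof.
move: rho_lb; rewrite ler_pdivrMr; first by rewrite mulrCA mulrA.
by rewrite mulr_gt0// ltr_wpDl ?sqr_ge0.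
Qed.

Let rho0 : 0 < rho.
Proof.
apply: lt_le_trans rho_lb; rewrite divr_gt0 ?mulr_gt0 ?exprn_gt0 ?subr_gt0//.
by rewrite ltr_wpDl ?sqr_ge0.
Qed.

Let tau1_gt0 : 0 < tau1.
Proof.
have l1' := l1; have lr := mulr_gt0 l0 rho0.
by rewrite /tau1; apply: mulr_gt0; lra.
Qed.

Let tau1_lt1 : tau1 < 1.
Proof.
rewrite /tau1; have l0' := l0; have l1' := l1; have := rho_ub; have := rho0.
move: rho => x x0 x1.
have h1 : l * x < l by rewrite gtr_pMr.
have h2 : 2 * l * x + 1 - l < 1 + l by lra.
have h3 : (1 - l) * (2 * l * x + 1 - l) < (1 - l) * (1 + l) by rewrite ltr_pM2l ?subr_gt0.
by apply: lt_le_trans h3 _; nra.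
Qed.

(** This is the lower bound on rho, cleared of denominators. *)
Let tau1_le : tau1 <= 2 * rho.
Proof. by rewrite /tau1; move: rho_lb'; lra. Qed.

Lemma pair_limit_le s : 0 <= s -> s <= l -> pair_limit l s = s ^+ 2 * A.
Proof. by move=> s0 sl; rewrite /pair_limit min_l// subrr mulr0 expr0n/=; ring. Qed.

Lemma pair_limit_ge s : l <= s -> pair_limit l s - s ^+ 2 * A =
  (D - A) * ((s - l) * (2 * l * rho + (s - l))).
Proof.
move=> ls; rewrite /pair_limit min_r//.
have -> : B = A + (D - A) * rho by rewrite /rho mulrC divfK// addrC subrK.
ring.
Qed.

Lemma pair_limit_1 : pair_limit l 1 - A = (D - A) * tau1.
Proof.
have := pair_limit_ge (ltW l1); rewrite expr1n mul1r => ->.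
by rewrite /tau1; congr (_ * _); ring.
Qed.

Lemma profile_le s : 0 < s -> s <= l -> profile s = s * (`|D - A| * tau1).
Proof.
move=> s0 sl; rewrite /profile pair_limit_le//; last exact: ltW.
rewrite (_ : _ - _ = - (s * ((D - A) * tau1))).
  by rewrite normrN normrM (gtr0_norm s0) normrM (gtr0_norm tau1_gt0).
by rewrite -pair_limit_1; field; rewrite gt_eqF.
Qed.

Lemma profile_ge s : l <= s -> profile s =
  `|D - A| * `|(s - l) * (2 * l * rho + (s - l)) - s ^+ 2 * tau1| / s.
Proof.
move=> ls; have s0 : 0 < s by exact: lt_le_trans ls.
rewrite -normrM -[X in _ / X](gtr0_norm s0) -normf_div /profile; congr `|_|.
have h1 := pair_limit_ge ls; have h2 := pair_limit_1.
have -> : pair_limit l s = (D - A) * ((s - l) * (2 * l * rho + (s - l))) + s ^+ 2 * A.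
  by rewrite -h1 subrK.
have -> : pair_limit l 1 = (D - A) * tau1 + A by rewrite -h2 subrK.
by field; rewrite gt_eqF.
Qed.

(** In the scale where A is 0 and D is 1, put u = s - l and
    v = u (2 l rho + u).  Before l the profile is s tau1.  After l it is
    |v - s^2 tau1| / s, and has to stay below l tau1:
    - v - s^2 tau1 + l tau1 s = u^2 (1 - tau1) + u l (2 rho - tau1), which is
      positive because tau1 <= 2 rho and tau1 < 1;
    - l tau1 s - v + s^2 tau1 is at least
      s (1 - l) l (2 (1 - rho) - (s + l) (1 - 2 rho)), because u <= s (1 - l),
      and the last factor is at least 2 (1 - rho) if rho >= 1/2 and at least
      1 - l otherwise. *)
Lemma profile_gap (e : R) : 0 < e -> exists2 gap, 0 < gap &
  forall s, 0 < s <= 1 -> e < `|s - l| -> profile s <= profile l - gap.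
Proof.
move=> e0.
have DA1 : 0 < `|D - A| by rewrite normr_gt0.
(* The margins in the three cases of the comment above. *)
pose g1 := e * tau1; pose g2 := e ^+ 2 * (1 - tau1).
pose g3 := l * (1 - l) * Num.min (2 * (1 - rho)) (1 - l).
have g10 : 0 < g1 by exact: mulr_gt0.
have g20 : 0 < g2 by rewrite mulr_gt0 ?exprn_gt0 ?subr_gt0.
have g30 : 0 < g3.
  by rewrite !mulr_gt0 ?subr_gt0// lt_min mulr_gt0 ?subr_gt0//=.
pose g := Num.min g1 (Num.min g2 g3).
have [gg1 gg2 gg3] : [/\ g <= g1, g <= g2 & g <= g3].
  by rewrite /g !ge_min !lexx ?orbT; split.
have g0 : 0 < g by rewrite !lt_min g10 g20 g30.
exists (`|D - A| * g); first exact: mulr_gt0.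
move=> s /andP[s0 s1] es.
rewrite (profile_le l0 (lexx l)).
have [sl|ls] := leP s l.
  rewrite (profile_le s0 sl).
  have : e < l - s by move: es; rewrite ler0_norm ?subr_le0// opprB.
  move=> els; rewrite -subr_ge0.
  have -> : l * (`|D - A| * tau1) - `|D - A| * g - s * (`|D - A| * tau1) =
    `|D - A| * ((l - s) * tau1 - g) by ring.
  rewrite mulr_ge0// subr_ge0 (le_trans gg1)// /g1 ler_wpM2r// ltW//.
have eu : e < s - l by move: es; rewrite ger0_norm// subr_ge0 ltW.
rewrite (profile_ge (ltW ls)).
rewrite [l * (_ * _)]mulrCA -mulrBr -[leLHS]mulrA ler_wpM2l// ler_pdivrMr// ler_norml.
have := rho0; have := rho_ub; have := tau1_le; have := tau1_lt1; have := tau1_gt0.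
have gs : g * s <= g by rewrite ger_pMr.
have l0' := l0; have l1' := l1.
have tauE : tau1 = (1 - l) * (2 * l * rho + 1 - l) by [].
have gg2' : g <= e ^+ 2 * (1 - tau1) by [].
have gg3' : g <= l * (1 - l) * Num.min (2 * (1 - rho)) (1 - l) by [].
clear gg1 gg2 gg3; move: tauE gg2' gg3' gs g0 eu; clearbody g; move: tau1 rho g => t x g'.
move=> tE gg2' gg3' gs g'0 eu t0 t1 tx x1 x0.
pose u := s - l; have sE : s = l + u by rewrite /u; ring.
have u0 : 0 < u by exact: lt_trans eu.
rewrite -/u.
apply/andP; split.
  have h1 : e ^+ 2 * (1 - t) <= u ^+ 2 * (1 - t).
    by apply: ler_wpM2r; [rewrite subr_ge0 ltW|rewrite ler_sqr ?nnegrE; apply/ltW].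
  have h2 : 0 <= u * (l * (2 * x - t)) by rewrite !mulr_ge0 ?subr_ge0// ltW.
  rewrite -subr_ge0.
  have -> : u * (2 * l * x + u) - s ^+ 2 * t - - ((l * t - g') * s) =
    u ^+ 2 * (1 - t) + u * (l * (2 * x - t)) - g' * s by rewrite sE; ring.
  lra.
have br : Num.min (2 * (1 - x)) (1 - l) <= 2 * (1 - x) - (s + l) * (1 - 2 * x).
  have [x2|x2] := leP (1 - 2 * x) 0.
    rewrite ge_min; apply/orP; left.
    have : (s + l) * (1 - 2 * x) <= 0 by rewrite mulr_ge0_le0// addr_ge0// ltW.
    lra.
  rewrite ge_min; apply/orP; right.
  have : (s + l) * (1 - 2 * x) <= (1 + l) * (1 - 2 * x).
    by rewrite ler_wpM2r ?lerD2r// ltW.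
  have : 0 < l * x by exact: mulr_gt0.
  lra.
have h3 : g' * s <= s * (1 - l) * (l * (2 * (1 - x) - (s + l) * (1 - 2 * x))).
  have -> : s * (1 - l) * (l * (2 * (1 - x) - (s + l) * (1 - 2 * x))) =
    l * (1 - l) * (2 * (1 - x) - (s + l) * (1 - 2 * x)) * s by ring.
  rewrite ler_wpM2r ?(ltW s0)// (le_trans gg3')// ler_wpM2l//.
  by rewrite mulr_ge0 ?subr_ge0// ltW.
have h4 : u * (2 * l * x + u) <= s * (1 - l) * (2 * l * x + u).
  apply: ler_wpM2r; first by rewrite addr_ge0 ?mulr_ge0// ltW.
  have : 0 <= l * (1 - s) by rewrite mulr_ge0 ?subr_ge0// ltW.
  rewrite /u; lra.
rewrite -subr_ge0.
have -> : (l * t - g') * s - (u * (2 * l * x + u) - s ^+ 2 * t) =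
  (s * (1 - l) * (l * (2 * (1 - x) - (s + l) * (1 - 2 * x))) - g' * s) +
  (s * (1 - l) * (2 * l * x + u) - u * (2 * l * x + u)) by rewrite tE /u; ring.
by rewrite addr_ge0// subr_ge0.
Qed.

End limit_profile.

Section pair_limit_bounds.
Context {R : realType}.
Variables (A B D : R).
Hypotheses (A1 : `|A| <= 1) (B1 : `|B| <= 1) (D1 : `|D| <= 1).

Lemma norm_quadratic (a b : R) : 0 <= a -> 0 <= b ->
  `|a ^+ 2 * A + 2 * (a * b) * B + b ^+ 2 * D| <= (a + b) ^+ 2.
Proof.
move=> a0 b0.
have -> : (a + b) ^+ 2 = a ^+ 2 * 1 + 2 * (a * b) * 1 + b ^+ 2 * 1 by ring.
apply: le_trans (ler_normD _ _) _; apply: lerD; last first.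
  by rewrite normrM ger0_norm ?sqr_ge0// ler_wpM2l ?sqr_ge0.
apply: le_trans (ler_normD _ _) _; apply: lerD.
  by rewrite normrM ger0_norm ?sqr_ge0// ler_wpM2l ?sqr_ge0.
have ab0 : 0 <= 2 * (a * b) by rewrite !mulr_ge0.
by rewrite normrM (ger0_norm ab0) ler_wpM2l.
Qed.

Lemma norm_pair_limit (l s : R) : 0 <= l -> 0 <= s -> `|pair_limit A B D l s| <= s ^+ 2.
Proof.
move=> l0 s0; have [m0 ms] : 0 <= Num.min s l /\ Num.min s l <= s.
  by rewrite le_min s0 l0 ge_min lexx.
have := norm_quadratic m0 (_ : 0 <= s - Num.min s l).
by rewrite subr_ge0 => /(_ ms); rewrite [Num.min s l + _]addrC subrK.
Qed.

Lemma pair_limit_lipschitz (l l' s : R) : 0 <= l -> 0 <= l' -> 0 <= s <= 1 ->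
  `|pair_limit A B D l s - pair_limit A B D l' s| <= 6 * `|l - l'|.
Proof.
move=> l0 l'0 /andP[s0 s1]; rewrite /pair_limit.
have minD : `|Num.min s l - Num.min s l'| <= `|l - l'|.
  by have [sl|sl] := leP s l; have [sl'|sl'] := leP s l'; rewrite ler_norml;
    have := ler_norm (l - l'); have := ler_norm (l' - l); rewrite [`|l' - l|]distrC;
    move=> ? ?; apply/andP; split; lra.
have [m0 ms] : 0 <= Num.min s l /\ Num.min s l <= s.
  by rewrite le_min s0 l0 ge_min lexx.
have [m'0 m's] : 0 <= Num.min s l' /\ Num.min s l' <= s.
  by rewrite le_min s0 l'0 ge_min lexx.
move: minD m0 ms m'0 m's; move: (Num.min s l) (Num.min s l') `|l - l'| => a a' e.
move=> aa' a0 as_ a'0 a's.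
rewrite (_ : _ - _ = (a - a') * ((a + a') * A + 2 * (s - a - a') * B
  + (a + a' - 2 * s) * D)); last by ring.
rewrite normrM mulrC; apply: ler_pM => //.
apply: le_trans (ler_normD _ _) _.
apply: (@le_trans _ _ (4 + 2)); last by lra.
apply: lerD; last first.
  by rewrite normrM -[2]mulr1 ler_pM// ler_norml; apply/andP; split; lra.
apply: le_trans (ler_normD _ _) _; apply: (@le_trans _ _ (2 + 2)); last by lra.
apply: lerD.
  by rewrite normrM -[2]mulr1 ler_pM// ler_norml; apply/andP; split; lra.
by rewrite normrM -[2]mulr1 ler_pM// ler_norml; apply/andP; split; lra.
Qed.

End pair_limit_bounds.

(** * The change-point criterion and its limit *)

Section sample_statistics.
Context {R : realType}.
Variable p : nat -> R * R.

Definition pair_sum (k : nat) : R :=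
  \sum_(1 <= i < k.+1) \sum_(1 <= j < k.+1) kendall_kernel (p i) (p j).

Lemma pair_sumE k :
  pair_sum k = 2 * \sum_(1 <= j < k.+1) \sum_(1 <= i < j) kendall_kernel (p i) (p j).
Proof.
rewrite /pair_sum; elim: k => [|k IH]; first by rewrite !big_geq// mulr0.
rewrite big_nat_recr//= [in RHS]big_nat_recr//= mulrDr -IH.
under eq_bigr do rewrite big_nat_recr//=.
rewrite big_split/= -addrA; congr (_ + _).
rewrite [X in _ + X]big_nat_recr//= kendall_kernelxx addr0 mulr2n mulrDl mul1r; congr (_ + _).
by apply: eq_bigr => j _; exact: kendall_kernelC.
Qed.

Lemma sample_tauE k : sample_tau p k = pair_sum k / (k%:R * (k%:R - 1)).
Proof. by rewrite /sample_tau pair_sumE; ring. Qed.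

Lemma norm_pair_sum k : `|pair_sum k| <= k%:R ^+ 2.
Proof.
apply: le_trans (ler_norm_sum _ _ _) _.
apply: (@le_trans _ _ (\sum_(1 <= i < k.+1) k%:R)); last first.
  by rewrite sumr_const_nat subn1/= -[_ *+ _]mulr_natl expr2.
apply: ler_sum => i _; apply: le_trans (ler_norm_sum _ _ _) _.
apply: (@le_trans _ _ (\sum_(1 <= i < k.+1) 1)).
  by apply: ler_sum => j _; exact: kendall_kernel_norm_le1.
by rewrite sumr_const_nat subn1.
Qed.

(** The normalisations k (k - 1) and k^2 differ by a relative error 1 / (k - 1),
    which costs k / (n (k - 1)) <= 2 / n.  For k = 1 both terms are 0. *)
Lemma scaled_sample_tau (n k : nat) : (1 <= k <= n)%N ->
  `|k%:R / n%:R * sample_tau p k - (pair_sum k / n%:R ^+ 2) / (k%:R / n%:R)| <= 2 / n%:R.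
Proof.
case/andP=> k1 kn; rewrite sample_tauE.
have n0 : 0 < n%:R :> R by rewrite ltr0n (leq_trans k1).
have [k1'|k2] := leqP k 1.
  have -> : k = 1%N by apply/eqP; rewrite eqn_leq k1'.
  by rewrite /pair_sum !big_nat1 kendall_kernelxx !mul0r mulr0 subr0 normr0 divr_ge0.
have k0 : 0 < k%:R :> R by rewrite ltr0n.
have k2R : 2 <= k%:R :> R by rewrite ler_nat.
have -> : k%:R / n%:R * (pair_sum k / (k%:R * (k%:R - 1))) -
    pair_sum k / n%:R ^+ 2 / (k%:R / n%:R) =
    pair_sum k / (n%:R * k%:R * (k%:R - 1)).
  by field; rewrite !gt_eqF//; lra.
have d0 : 0 < n%:R * k%:R * (k%:R - 1) :> R by rewrite !mulr_gt0//; lra.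
rewrite normrM normfV (gtr0_norm d0) ler_pdivrMr//.
apply: le_trans (norm_pair_sum k) _.
rewrite (_ : 2 / n%:R * _ = 2 * k%:R * (k%:R - 1)); last by field; rewrite gt_eqF.
nra.
Qed.

Variables (A B D l : R).
Hypotheses (A1 : `|A| <= 1) (B1 : `|B| <= 1) (D1 : `|D| <= 1).
Hypothesis l0 : 0 <= l.

(** Dividing the error e by k / n is harmless as long as k / n >= rho; for
    smaller k both quantities are at most k / n. *)
Lemma change_stat_approx (n k : nat) (e rho : R) : (1 <= k <= n)%N -> 0 <= e -> 0 < rho ->
  (forall k, (k <= n)%N ->
    `|pair_sum k / n%:R ^+ 2 - pair_limit A B D l (k%:R / n%:R)| <= e) ->
  `|k%:R / n%:R * `|sample_tau p k - sample_tau p n| - profile A B D l (k%:R / n%:R)| <=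
  4 / n%:R + e + (e / rho + 2 * rho).
Proof.
move=> /[dup] kn /andP[k1 kn'] e0 rho0 near_limit.
have n1 : (1 <= n)%N by exact: leq_trans k1 kn'.
have n0 : 0 < n%:R :> R by rewrite ltr0n.
pose s : R := k%:R / n%:R.
have s0 : 0 < s by rewrite divr_gt0 ?ltr0n.
have s1 : s <= 1 by rewrite ler_pdivrMr// mul1r ler_nat.
rewrite -/s.
have hk := scaled_sample_tau kn; rewrite -/s in hk.
have hn : `|sample_tau p n - pair_sum n / n%:R ^+ 2| <= 2 / n%:R.
  have := scaled_sample_tau (_ : (1 <= n <= n)%N); rewrite n1 leqnn => /(_ isT).
  by rewrite divff ?gt_eqF// mul1r divr1.
have en : `|pair_sum n / n%:R ^+ 2 - pair_limit A B D l 1| <= e.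
  by have := near_limit n (leqnn _); rewrite divff ?gt_eqF.
have ek : `|(pair_sum k / n%:R ^+ 2) / s - pair_limit A B D l s / s| <= e / rho + 2 * rho.
  have [sr|rs] := leP rho s.
    rewrite -mulrBl normrM normfV (gtr0_norm s0).
    apply: (@le_trans _ _ (e / rho)); last by rewrite lerDl mulr_ge0// ltW.
    by apply: ler_pM => //; [rewrite invr_ge0 ltW|exact: near_limit|rewrite lef_pV2].
  apply: (@le_trans _ _ (2 * rho)); last by rewrite lerDr divr_ge0// ltW.
  apply: le_trans (ler_normB _ _) _.
  have b1 : `|pair_sum k / n%:R ^+ 2 / s| <= s.
    rewrite normrM normfV (gtr0_norm s0) ler_pdivrMr// normrM normfV.
    rewrite (ger0_norm (sqr_ge0 n%:R)) -expr2 /s expr_div_n ler_wpM2r ?invr_ge0 ?sqr_ge0//.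
    exact: norm_pair_sum.
  have b2 : `|pair_limit A B D l s / s| <= s.
    rewrite normrM normfV (gtr0_norm s0) ler_pdivrMr// -expr2.
    by apply: norm_pair_limit => //; exact: ltW.
  lra.
rewrite -[s in s * `|_|](gtr0_norm s0) -normrM /profile.
apply: le_trans (ler_dist_dist _ _) _.
have -> : s * (sample_tau p k - sample_tau p n) -
    (pair_limit A B D l s / s - s * pair_limit A B D l 1) =
  (s * sample_tau p k - pair_sum k / n%:R ^+ 2 / s) +
  (pair_sum k / n%:R ^+ 2 / s - pair_limit A B D l s / s) -
  s * ((sample_tau p n - pair_sum n / n%:R ^+ 2) +
       (pair_sum n / n%:R ^+ 2 - pair_limit A B D l 1)) by ring.
apply: le_trans (ler_normB _ _) _.
have c1 := ler_normD (s * sample_tau p k - pair_sum k / n%:R ^+ 2 / s)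
  (pair_sum k / n%:R ^+ 2 / s - pair_limit A B D l s / s).
have c2 : `|s * ((sample_tau p n - pair_sum n / n%:R ^+ 2) +
       (pair_sum n / n%:R ^+ 2 - pair_limit A B D l 1))| <= 2 / n%:R + e.
  rewrite normrM (gtr0_norm s0).
  apply: (@le_trans _ _ (1 * (2 / n%:R + e))); last by rewrite mul1r.
  apply: ler_pM => //; first exact: ltW.
  by apply: le_trans (ler_normD _ _) _; exact: lerD.
have -> : 4 / n%:R = 2 / n%:R + 2 / n%:R :> R by field; rewrite gt_eqF.
lra.
Qed.

End sample_statistics.

Section cross_tau_facts.
Context {R : realType}.
Implicit Types F G : probability (R * R)%type R.

Lemma norm_cross_tau F G : `|cross_tau F G| <= 1.
Proof.
pose Q := [the probability _ R of (F \x G)%E].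
have ik := integrable_kendall_kernel Q.
apply: le_trans (le_normr_Rintegral measurableT ik) _.
have -> : 1 = \int[Q]_z (cst 1 z) :> R.
  by rewrite Rintegral_cst// mul1r [X in fine X](probability_setT Q).
apply: le_Rintegral => //.
- exact: integrable_norm.
- exact: finite_measure_integrable_cst.
- by move=> z _; exact: kendall_kernel_norm_le1.
Qed.

Lemma rank_kernelC K (A B : 'I_K * 'I_K) : rank_kernel A B = rank_kernel B A :> R.
Proof. by rewrite /rank_kernel -opprB sgrN -[B.2%:R - _]opprB sgrN mulrNN. Qed.

(** The discretised kernel is symmetric and approximates cross_tau F G and
    cross_tau G F with arbitrary precision. *)
Lemma cross_tauC F G : lipschitz (cdf2 F) -> lipschitz (cdf2 G) ->
  cross_tau F G = cross_tau G F.
Proof.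
move=> lF lG; apply/eqP; rewrite -subr_eq0 -normr_le0; apply/ler_addgt0Pl => e e0.
rewrite addr0.
have e40 : 0 < e / 4 by rewrite divr_gt0.
have [K [rk rkP]] := fine_grid_exists lF lG e40.
have approx H1 H2 : H2 = F \/ H2 = G -> `|cross_tau H1 H2 -
    bilin (@rank_kernel R K) (cell_mass rk H1) (cell_mass rk H2)| <= 2 * (e / 4).
  move=> HFG; apply: le_trans (cross_tau_approx (grid_homo rkP) (grid_measurable rkP) _ _) _.
  by apply: (collision_mass_le (grid_measurable rkP)) => u;
    [apply: (grid_vsmall rkP)|apply: (grid_hsmall rkP)].
have sym : bilin (@rank_kernel R K) (cell_mass rk F) (cell_mass rk G) =
    bilin (@rank_kernel R K) (cell_mass rk G) (cell_mass rk F).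
  rewrite /bilin exchange_big/=; apply: eq_bigr => A _; apply: eq_bigr => B _.
  by rewrite rank_kernelC [cell_mass _ _ _ * _]mulrC.
have h1 := approx F G (or_intror erefl); have h2 := approx G F (or_introl erefl).
rewrite -sym in h2; move: h1 h2; rewrite !ler_norml => /andP[? ?] /andP[? ?].
apply/andP; split; lra.
Qed.

End cross_tau_facts.

Section uniform_approximation.
Variables (R : realType) (lam : R) (F G : probability (R * R)%type R)
    (d : nat -> measure_display) (T : forall n : nat, measurableType (d n))
    (P : forall n : nat, probability (T n) R)
    (W : forall n : nat, nat -> {RV (P n) >-> (R * R)%type}).
Hypothesis lam01 : 0 < lam < 1.
Hypothesis lipF : lipschitz (cdf2 F).
Hypothesis lipG : lipschitz (cdf2 G).
Hypothesis LLN : forall C : set (R * R), measurable C ->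
  continuity_set F C -> continuity_set G C ->
  forall eta eps, 0 < eta -> 0 < eps -> \forall n \near \oo,
  exists E, [/\ measurable E, (P n E <= eps%:E)%E &
    forall w, ~ E w -> forall k, (k <= n)%N ->
    `|\sum_(1 <= i < k.+1) (\1_C (W n i w) - fine (regime_law lam F G n i C))|
      <= eta * n%:R].

Let A := kendall_tau F.
Let B := cross_tau F G.
Let D := kendall_tau G.

Lemma change_point_near n : (0 < n)%N ->
  `|(Num.truncn (lam * n%:R))%:R / n%:R - lam| <= n%:R^-1.
Proof.
move=> n0; have nR : 0 < n%:R :> R by rewrite ltr0n.
case/andP: lam01 => l0 l1.
have x0 : 0 <= lam * n%:R by rewrite mulr_ge0// ltW.
have h1 : (Num.truncn (lam * n%:R))%:R <= lam * n%:R by rewrite truncn_le.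
have h2 : lam * n%:R < (Num.truncn (lam * n%:R)).+1%:R by rewrite -truncn_le_nat.
have -> : (Num.truncn (lam * n%:R))%:R / n%:R - lam =
    ((Num.truncn (lam * n%:R))%:R - lam * n%:R) / n%:R by field; rewrite gt_eqF.
rewrite normrM normfV (gtr0_norm nR) ler_piMl ?invr_ge0//.
move: h1 h2; rewrite -[_.+1%:R]natr1 => h1 h2.
by rewrite ler_norml; apply/andP; split; lra.
Qed.

(** The law at time i is F or G according to the indicator a i, so cross_tau at
    (i, j) is bilinear in (a i, 1 - a i) and (a j, 1 - a j); the sums of these
    weights over i <= k are min k m and k - min k m. *)
Lemma sum_cross_tau n k : (0 < n)%N -> (k <= n)%N ->
  \sum_(1 <= i < k.+1) \sum_(1 <= j < k.+1)
     cross_tau (regime_law lam F G n i) (regime_law lam F G n j) =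
  n%:R ^+ 2 * pair_limit A B D ((Num.truncn (lam * n%:R))%:R / n%:R) (k%:R / n%:R).
Proof.
move=> n0 kn; have nR : 0 < n%:R :> R by rewrite ltr0n.
set m := Num.truncn _.
pose a i : R := (i <= m)%N%:R.
have cE i j : cross_tau (regime_law lam F G n i) (regime_law lam F G n j) =
    a i * a j * A + (a i * (1 - a j) + (1 - a i) * a j) * B + (1 - a i) * (1 - a j) * D.
  rewrite /regime_law -/m /a; case: (i <= m)%N; case: (j <= m)%N;
    rewrite /A /B /D /kendall_tau /= ?(cross_tauC lipG lipF); ring.
pose al : R := \sum_(1 <= i < k.+1) a i.
pose be : R := \sum_(1 <= i < k.+1) (1 - a i).
have alE : al = (minn k m)%:R.
  rewrite /al; elim: (k) => [|k' IH]; first by rewrite big_geq// min0n.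
  rewrite big_nat_recr//= IH /a -natrD; congr _%:R; lia.
have beE : be = k%:R - al by rewrite /be sumrB sumr_const_nat subn1.
transitivity (al ^+ 2 * A + 2 * (al * be) * B + be ^+ 2 * D).
  under eq_bigr => i _.
    rewrite (_ : \sum_(1 <= j < k.+1) _ = (a i * al) * A + (a i * be + (1 - a i) * al) * B
      + (1 - a i) * be * D); first over.
    under eq_bigr do rewrite cE.
    by rewrite !big_split/= -!mulr_suml big_split/= -!mulr_sumr.
  rewrite !big_split/= -!mulr_suml big_split/= -!mulr_suml -/al -/be; ring.
have -> : pair_limit A B D (m%:R / n%:R) (k%:R / n%:R) =
    (al / n%:R) ^+ 2 * A + 2 * (al / n%:R * (be / n%:R)) * B + (be / n%:R) ^+ 2 * D.
  have minE : Num.min (k%:R / n%:R) (m%:R / n%:R) = al / n%:R.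
    rewrite alE; have [km|mk] := leqP k m.
      by rewrite min_l// ler_wpM2r ?invr_ge0// ler_nat.
    by rewrite min_r// ler_wpM2r ?invr_ge0// ler_nat ltnW.
  by rewrite /pair_limit minE beE mulrBl.
by field; rewrite gt_eqF.
Qed.

(** The exceptional events of the law of large numbers for the finitely many
    cells are collected in one event.  Replacing the actual fraction m / n by
    lam costs at most 6 / n, since pair_limit is Lipschitz in its first
    argument. *)
Lemma pair_sum_uniform e eps : 0 < e -> 0 < eps -> \forall n \near \oo,
  exists E, [/\ measurable E, (P n E <= eps%:E)%E &
    forall w, ~ E w -> forall k, (k <= n)%N ->
    `|pair_sum (fun i => W n i w) k / n%:R ^+ 2 - pair_limit A B D lam (k%:R / n%:R)| <= e].
Proof.
move=> e0 eps0.
have e160 : 0 < e / 16 by rewrite divr_gt0.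
have [K [rk rkP]] := fine_grid_exists lipF lipG e160.
pose N : R := #|{: 'I_K * 'I_K}|%:R.
have N0 : 0 <= N by [].
pose eta := e / (24 * (N ^+ 2 + 1)).
have eta0 : 0 < eta by rewrite divr_gt0// mulr_gt0// ltr_wpDl ?sqr_ge0.
pose eps' := eps / (N + 1).
have eps'0 : 0 < eps' by rewrite divr_gt0// ltr_wpDl.
have near_cells : \forall n \near \oo, forall c : 'I_K * 'I_K,
  exists E, [/\ measurable E, (P n E <= eps'%:E)%E &
    forall w, ~ E w -> forall k, (k <= n)%N ->
    `|\sum_(1 <= i < k.+1) (\1_[set p | cell rk p = c] (W n i w) -
        cell_mass rk (regime_law lam F G n i) c)| <= eta * n%:R].
  apply: filter_forall => c; apply: LLN => //.
  - exact: (measurable_cell (grid_measurable rkP)).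
  - by rewrite cell_eqE; apply: (grid_continuity rkP); left.
  - by rewrite cell_eqE; apply: (grid_continuity rkP); right.
near=> n.
have n0 : (0 < n)%N by near: n; exists 1%N.
have nR : 0 < n%:R :> R by rewrite ltr0n.
have n_e : 12 / e <= n%:R by near: n; exact: nbhs_infty_ger.
have /choice[E EP] : forall c : 'I_K * 'I_K,
  exists E, [/\ measurable E, (P n E <= eps'%:E)%E &
    forall w, ~ E w -> forall k, (k <= n)%N ->
    `|\sum_(1 <= i < k.+1) (\1_[set p | cell rk p = c] (W n i w) -
        cell_mass rk (regime_law lam F G n i) c)| <= eta * n%:R].
  by near: n.
have [|S [mS PS ES]] := @union_bound _ _ _ (P n) _ (enum {: 'I_K * 'I_K}) E eps'.
  by move=> c _; have [] := EP c.
exists S; split => //.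
  apply: le_trans PS _; rewrite lee_fin -cardE -/N /eps'.
  by rewrite mulrCA ger_pMr// ler_pdivrMr ?ltr_wpDl// mul1r lerDl.
move=> w Sw k kn.
have dev c : `|\sum_(1 <= i < k.+1) (\1_[set p | cell rk p = c] (W n i w) -
    cell_mass rk (regime_law lam F G n i) c)| <= eta * n%:R.
  have [_ _ h] := EP c; apply: h => // Ew; apply: Sw; apply: (ES c) Ew.
  by rewrite mem_enum.
have main := pair_sum_approx rkP kn dev.
set m := Num.truncn (lam * n%:R).
have main' : `|pair_sum (fun i => W n i w) k / n%:R ^+ 2 -
    pair_limit A B D (m%:R / n%:R) (k%:R / n%:R)| <= e / 2.
  have n20 : 0 < n%:R ^+ 2 :> R by rewrite exprn_gt0.
  rewrite (_ : _ - _ = (\sum_(1 <= i < k.+1) \sum_(1 <= j < k.+1)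
     (kendall_kernel (W n i w) (W n j w) -
      cross_tau (regime_law lam F G n i) (regime_law lam F G n j)))
     / n%:R ^+ 2); last first.
    under eq_bigr do rewrite sumrB.
    rewrite sumrB sum_cross_tau// mulrBl; congr (_ - _).
    by rewrite [_ * pair_limit _ _ _ _ _]mulrC mulfK// gt_eqF.
  rewrite normrM normfV (gtr0_norm n20) ler_pdivrMr//.
  apply: le_trans main _; rewrite -/N ler_wpM2r ?(ltW n20)//.
  have : N ^+ 2 * eta <= e / 24.
    rewrite /eta mulrA ler_pdivrMr; last by rewrite mulr_gt0// ltr_wpDl ?sqr_ge0.
    have -> : e / 24 * (24 * (N ^+ 2 + 1)) = N ^+ 2 * e + e by field.
    by rewrite lerDl ltW.
  lra.
have lip : `|pair_limit A B D (m%:R / n%:R) (k%:R / n%:R) -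
    pair_limit A B D lam (k%:R / n%:R)| <= e / 2.
  have m0 : 0 <= m%:R / n%:R :> R by rewrite divr_ge0.
  have l0 : 0 <= lam by case/andP: lam01 => /ltW.
  have s01 : (0 <= k%:R / n%:R :> R) && (k%:R / n%:R <= 1 :> R).
    by apply/andP; split; [exact: divr_ge0|rewrite ler_pdivrMr// mul1r ler_nat].
  apply: le_trans (pair_limit_lipschitz (norm_cross_tau F F) (norm_cross_tau F G)
    (norm_cross_tau G G) m0 l0 s01) _.
  have := change_point_near n0; rewrite -/m.
  have : 6 * n%:R^-1 <= e / 2.
    rewrite ler_pdivrMr//; move: n_e; rewrite ler_pdivrMr//; lra.
  lra.
rewrite -(subrKA (pair_limit A B D (m%:R / n%:R) (k%:R / n%:R))).
apply: le_trans (ler_normD _ _) _; lra.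
Unshelve. all: by end_near.
Qed.

End uniform_approximation.

(** * Localisation of the maximiser *)

Section argmax.
Context {R : realType}.

Lemma change_statE (p : nat -> R * R) (n k : nat) : (0 < n)%N ->
  change_stat p n k = Num.sqrt n%:R * (k%:R / n%:R * `|sample_tau p k - sample_tau p n|).
Proof.
move=> n0; rewrite /change_stat.
set q := Num.sqrt n%:R.
have q0 : q != 0 by rewrite gt_eqF// sqrtr_gt0 ltr0n.
have -> : n%:R = q * q :> R by rewrite -expr2 sqr_sqrtr.
by field.
Qed.

Variables (A B D l : R).
Hypotheses (A1 : `|A| <= 1) (B1 : `|B| <= 1) (D1 : `|D| <= 1).
Hypothesis l01 : 0 < l < 1.
Hypothesis AD : A != D.
Hypothesis rho_lb : (1 - l) ^+ 2 / (2 * ((1 - l) ^+ 2 + l)) <= (B - A) / (D - A).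
Hypothesis rho_ub : (B - A) / (D - A) < 1.

(** If the maximiser were eps away from l, the profile there would be below its
    maximum by gap, while the criterion at the maximiser is at least the
    criterion at m = [l n], where the profile is within O(1/n) of its maximum.
    The constants make each of the errors at most gap / 16. *)
Lemma argmax_near (eps : R) : 0 < eps -> exists2 e, 0 < e &
  \forall n \near \oo, forall (p : nat -> R * R) kh,
  (forall k, (k <= n)%N ->
    `|pair_sum p k / n%:R ^+ 2 - pair_limit A B D l (k%:R / n%:R)| <= e) ->
  is_argmax p n kh -> `|kh%:R / n%:R - l| <= eps.
Proof.
move=> eps0; have [l0 l1] := andP l01.
have [gap gap0 gapP] := profile_gap l01 AD rho_lb rho_ub eps0.
pose rho := gap / 32; have rho0 : 0 < rho by rewrite divr_gt0.
pose e := Num.min (gap / 16) (gap / 16 * rho).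
have e0 : 0 < e by rewrite lt_min divr_gt0//= mulr_gt0// divr_gt0.
have e1 : e <= gap / 16 by rewrite ge_min lexx.
have e2 : e / rho <= gap / 16 by rewrite ler_pdivrMr// ge_min lexx orbT.
have pl0 : 0 <= profile A B D l l by exact: normr_ge0.
exists e => //; near=> n => p kh near_limit [khn kh_max].
have n0 : (0 < n)%N by near: n; exists 1%N.
have nR : 0 < n%:R :> R by rewrite ltr0n.
have n_l : l^-1 <= n%:R by near: n; exact: nbhs_infty_ger.
have n_g : 64 / gap <= n%:R by near: n; exact: nbhs_infty_ger.
have n_p : 16 * (profile A B D l l / l) / gap <= n%:R by near: n; exact: nbhs_infty_ger.
set m := Num.truncn (l * n%:R).
have x0 : 0 <= l * n%:R by rewrite mulr_ge0// ltW.
have m_le : m%:R <= l * n%:R by rewrite truncn_le.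
have m_gt : l * n%:R < m.+1%:R by rewrite -truncn_le_nat.
have x1 : 1 <= l * n%:R by rewrite -ler_pdivrMl// mulr1.
have m1 : (1 <= m)%N.
  by rewrite lt0n; apply/negP => /eqP m0; move: m_gt; rewrite m0 ltNge x1.
have mn : (m <= n)%N.
  by rewrite -(ler_nat R) (le_trans m_le)// ger_pMl// ltW.
have approx k : (1 <= k <= n)%N -> _ :=
  fun kn => change_stat_approx A1 B1 D1 (ltW l0) kn (ltW e0) rho0 near_limit.
have mk : (1 <= m <= n)%N by rewrite m1.
have := kh_max m mk; rewrite !change_statE// ler_pM2l ?sqrtr_gt0//.
have := approx _ mk; have := approx _ khn.
have n4 : 4 / n%:R <= gap / 16.
  by rewrite ler_pdivrMr//; move: n_g; rewrite ler_pdivrMr//; lra.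
have rho2 : 2 * rho = gap / 16 by rewrite /rho; lra.
have ms0 : 0 < m%:R / n%:R :> R by rewrite divr_gt0// ltr0n.
have msl : m%:R / n%:R <= l by rewrite ler_pdivrMr.
have prof_m : profile A B D l l - gap / 16 <= profile A B D l (m%:R / n%:R).
  rewrite (profile_le l01 AD rho_lb ms0 msl).
  have pl := profile_le l01 AD rho_lb l0 (lexx l).
  move: n_p; rewrite pl; set z := (X in l * X); rewrite [l * z]mulrC mulfK ?gt_eqF//.
  have z0 : 0 <= z by move: pl0; rewrite pl -/z pmulr_rge0.
  rewrite ler_pdivrMr// => n_z.
  have : (z * l - gap / 16) * n%:R <= z * m%:R.
    have zm : z * (l * n%:R) <= z * (m%:R + 1) by rewrite ler_wpM2l// natr1 ltW.
    lra.
  rewrite -ler_pdivlMr// => zl.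
  have -> : m%:R / n%:R * z = z * m%:R / n%:R by rewrite mulrC mulrA.
  lra.
move=> at_kh at_m c1; rewrite leNgt; apply/negP => far.
move: at_kh at_m; rewrite !ler_norml => /andP[a1 a2] /andP[b1 b2].
have kR : (0 < kh%:R / n%:R :> R) && (kh%:R / n%:R <= 1 :> R).
  have /andP[k1 kn] := khn.
  by rewrite divr_gt0 ?ltr0n//= ler_pdivrMr// mul1r ler_nat.
have := gapP _ kR far.
lra.
Unshelve. all: by end_near.
Qed.

End argmax.

Theorem theorem4p2 (R : realType) (lam : R) (F G : probability (R * R)%type R)
    (d : nat -> measure_display) (T : forall n : nat, measurableType (d n))
    (P : forall n : nat, probability (T n) R)
    (W : forall n : nat, nat -> {RV (P n) >-> (R * R)%type})
    (r : nat -> nat)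
    (Z : forall n : nat, int -> {RV (P n) >-> ((r n).-tuple R)})
    (a : nat -> nat -> R) (Phi : nat -> nat -> R -> R)
    (delta C : R) (b : nat -> R) (khat : forall n : nat, T n -> nat) :
  0 < lam < 1 ->
  lipschitz (cdf2 F) -> lipschitz (cdf2 G) ->
  (forall n : nat, (0 < n)%N ->
     let m := Num.truncn (lam * n%:R) in
     [/\ stationary_on (P n) (W n) 1 m,
         stationary_on (P n) (W n) m.+1 n,
         forall i, (1 <= i <= m)%N -> forall A, measurable A ->
           distribution (P n) (W n i) A = F A &
         forall i, (m.+1 <= i <= n)%N -> forall A, measurable A ->
           distribution (P n) (W n i) A = G A]) ->
  (forall n : nat, (0 < n)%N ->
     absolutely_regular (P n) (Z n) /\
     P_NED (P n) n (W n) (Z n) (a n) (Phi n)) ->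
  0 < delta ->
  (\forall k \near \oo, forall n t : nat, (1 <= t <= n)%N ->
     a n k * Phi n t (k%:R ^- 6)
       <= C * k%:R `^ (- (6%:R * (2%:R + delta) / delta))) ->
  (forall n k : nat, (0 < n)%N -> (0 < k)%N ->
     (beta_coef (P n) (Z n) k <= (b k)%:E)%E) ->
  (\sum_(1 <= k <oo) (k%:R * b k `^ (delta / (2%:R + delta)))%:E < +oo)%E ->
  (forall n : nat, (0 < n)%N ->
     measurable_fun setT (khat n) /\
     forall w, is_argmax (fun i => W n i w) n (khat n w)) ->
  kendall_tau F != kendall_tau G ->
  (1 - lam) ^+ 2 / (2%:R * ((1 - lam) ^+ 2 + lam))
    <= (cross_tau F G - kendall_tau F) / (kendall_tau G - kendall_tau F) < 1 ->
  forall eps : R, 0 < eps ->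
    P n [set w | eps < `|(khat n w)%:R / n%:R - lam|] @[n --> \oo] --> 0%E.
Proof.
move=> lam01 lipF lipG lawFG regNED delta0 rate beta_le beta_rate khatP tauFG.
move=> /andP[rho_lb rho_ub] eps eps0.
have W_law n i : (1 <= i <= n)%N -> forall A, measurable A ->
    distribution (P n) (W n i) A = regime_law lam F G n i A.
  move=> /andP[i1 i_n] A mA.
  have n0 : (0 < n)%N by exact: leq_trans i_n.
  have [_ _ lF lG] := lawFG n n0.
  rewrite /regime_law; case: leqP => im; first by apply: lF => //; rewrite i1.
  by apply: lG => //; rewrite im.
have LLN := LLN_uniform W_law (fun n n0 => (regNED n n0).2) delta0 rate beta_le beta_rate.
have [e e0 argmax] := argmax_near (norm_cross_tau F F) (norm_cross_tau F G)
  (norm_cross_tau G G) lam01 tauFG rho_lb rho_ub eps0.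
pose S n := [set w | eps < `|(khat n w)%:R / n%:R - lam|].
have mS n : (0 < n)%N -> measurable (S n).
  move=> /khatP[mk _].
  rewrite (_ : S n = setT `&` khat n @^-1` [set k | eps < `|k%:R / n%:R - lam|]).
    exact: mk.
  by rewrite setTI.
apply/fine_cvgP; split.
  near=> n; apply: fin_num_measure; apply: mS; near: n; exists 1%N => //.
apply/cvgrPdist_le => e' e'0; near=> n.
have n0 : (0 < n)%N by near: n; exists 1%N.
rewrite /= sub0r normrN ger0_norm ?fine_ge0//.
have [E [mE PE close]] : exists E, [/\ measurable E, (P n E <= e'%:E)%E &
    forall w, ~ E w -> forall k, (k <= n)%N ->
    `|pair_sum (fun i => W n i w) k / n%:R ^+ 2 -
      pair_limit (kendall_tau F) (cross_tau F G) (kendall_tau G) lam (k%:R / n%:R)| <= e].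
  by near: n; exact: pair_sum_uniform.
rewrite -lee_fin fineK; last by apply: fin_num_measure; exact: mS.
(* Off the small event E the criterion is uniformly close to the profile. *)
apply: le_trans PE; apply: le_measure; rewrite ?inE//; first exact: mS.
move=> w /=; apply: contraPP => nE; apply/negP; rewrite -leNgt.
have am : forall (p : nat -> R * R) kh,
  (forall k, (k <= n)%N ->
    `|pair_sum p k / n%:R ^+ 2 -
      pair_limit (kendall_tau F) (cross_tau F G) (kendall_tau G) lam (k%:R / n%:R)| <= e) ->
  is_argmax p n kh -> `|kh%:R / n%:R - lam| <= eps by near: n.
by apply: am (close _ nE) _; have [_] := khatP n n0; exact.
Unshelve. all: by end_near.
Qed.
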